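(* Let $W\subset\mathbb P^3$ be a smooth complex quadric surface, and let $\nabla$ be the saturated collection of classes on $W$ consisting of the class of hyperplane sections of $W$ and the classes of the lines of the two rulings. Then there exists a pencil in $\mathbb P(H^0(W,\mathcal O_W(2)))$ with $6$ reducible members all of whose components have classes in $\nabla$.
   Context: A pencil is a line in the projectivization of the space of sections. A collection $\nabla$ of effective divisor classes is saturated if, whenever $D_1,D_2$ are effective with $D_1+D_2\in\nabla$, both $D_1$ and $D_2$ are in $\nabla$. *)

(* Defs.v *)
From mathcomp Require Export all_boot all_order all_algebra.
From mathcomp Require Export boolp classical_sets functions cardinality reals.
From mathcomp Require Export complex.
From mathcomp Require Export mpoly.

Set Implicit Arguments.
Unset Strict Implicit.
Unset Printing Implicit Defensive.

Import GRing.Theory.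
Local Open Scope classical_set_scope.
Local Open Scope ring_scope.

(* A point of P^3 is represented by any of its nonzero coordinate vectors, so
   that a subset of P^3 is given by the corresponding cone in K^4 \ {0}. *)

Section ProjectiveSurface.
Variable K : closedFieldType.

Definition vec := 'I_4 -> K.
Notation form := {mpoly K[4]}.

Definition zero_locus (A : set form) : set vec :=
  [set v | (exists i, v i != 0) /\ forall F, A F -> F.@[v] = 0].

Definition zariski_closed (X : set vec) : Prop :=
  exists A : set form,
    (forall F, A F -> exists d, F \is d.-homog) /\ X = zero_locus A.

Definition zariski_irreducible (X : set vec) : Prop :=
  X !=set0 /\
  forall Y Z : set vec, zariski_closed Y -> zariski_closed Z ->
    X `<=` Y `|` Z -> X `<=` Y \/ X `<=` Z.

Definition vanishing_ideal (X : set vec) : set form :=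
  [set F | forall v, X v -> F.@[v] = 0].

Definition smooth_quadric (W : set vec) : Prop :=
  exists q : form,
    [/\ q \is 2.-homog,
        W = zero_locus [set q]
      & forall v, W v -> exists i, (mderiv i q).@[v] != 0].

(* The regular sections of O_W(d): functions on the cone over W which are
   locally quotients of homogeneous polynomials, of total degree d. *)
Definition is_section (W : set vec) (d : nat) (s : vec -> K) : Prop :=
  forall v, W v -> exists (k : nat) (A B : form),
    [/\ A \is (k + d).-homog, B \is k.-homog, B.@[v] != 0
      & forall w, W w -> B.@[w] != 0 -> s w = A.@[w] / B.@[w]].

Definition of_form (F : form) : vec -> K := fun v => F.@[v].

(* The point of P(H^0(W, O_W(d))) defined by a section s; sections are compared
   on W only. *)
Definition proj_point (W : set vec) (s : vec -> K) : set (vec -> K) :=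
  [set t | exists2 c : K, c != 0 & forall w, W w -> t w = c * s w].

Definition is_pencil (W : set vec) (d : nat) (l : set (set (vec -> K))) : Prop :=
  exists s t : vec -> K,
    [/\ is_section W d s, is_section W d t,
        (forall a b : K, (forall w, W w -> a * s w + b * t w = 0) ->
           a = 0 /\ b = 0)
      & l = [set m | exists a b : K, (a != 0 \/ b != 0) /\
               m = proj_point W (fun w => a * s w + b * t w)]].

(* Irreducible closed subsets of codimension 1. *)
Definition is_prime_divisor (W C : set vec) : Prop :=
  [/\ zariski_closed C, zariski_irreducible C, C `<=` W, C <> W
    & forall Y, zariski_closed Y -> zariski_irreducible Y ->
        C `<=` Y -> Y `<=` W -> Y <> W -> Y = C].

Definition prime_divisor (W : set vec) := {C : set vec | is_prime_divisor W C}.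

Fixpoint ideal_pow (I : set form) (n : nat) : set form :=
  if n is m.+1 then
    [set F | exists s : seq (form * form),
       (forall ab, ab \in s -> I ab.1 /\ ideal_pow I m ab.2) /\
       F = \sum_(ab <- s) ab.1 * ab.2]
  else setT.

(* s lies in the n-th power of the maximal ideal of the coordinate ring of W
   localized at the ideal of C.  That ring is a discrete valuation ring when W is
   smooth, and on homogeneous s its valuation is that of O_{W,C}. *)
Definition vanishes_to_order (W C : set vec) (n : nat) (s : vec -> K) : Prop :=
  exists h G : form,
    [/\ ~ vanishing_ideal C h, ideal_pow (vanishing_ideal C) n G
      & forall w, W w -> h.@[w] * s w = G.@[w]].

(* The default value 0 is only reached by sections which are zero on W. *)
Definition ord (W C : set vec) (s : vec -> K) : nat :=
  xget 0%N [set n | vanishes_to_order W C n s /\ ~ vanishes_to_order W C n.+1 s].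

Section Divisors.
Variable W : set vec.

Definition divisor := prime_divisor W -> int.

Definition is_divisor (D : divisor) : Prop := finite_set [set C | D C != 0].

Definition effective (D : divisor) : Prop :=
  is_divisor D /\ forall C, 0 <= D C.

Definition zero_divisor : divisor := fun=> 0.

Definition add_divisor (D E : divisor) : divisor := fun C => D C + E C.

Definition of_prime (C : prime_divisor W) : divisor :=
  fun C' => if `[< C' = C >] then 1 else 0.

Definition div (s : vec -> K) : divisor := fun C => (ord W (sval C) s)%:Z.

(* D - E is the divisor of the rational function A / B on W. *)
Definition lin_equiv (D E : divisor) : Prop :=
  exists (d : nat) (A B : form),
    [/\ A \is d.-homog, B \is d.-homog,
        ~ vanishing_ideal W A, ~ vanishing_ideal W B
      & forall C, D C - E C = div (of_form A) C - div (of_form B) C].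

Definition div_class (D : divisor) : set divisor :=
  [set E | is_divisor E /\ lin_equiv D E].

(* Effective divisors are taken to be nonzero here, as otherwise the zero class
   would belong to every nonempty saturated collection. *)
Definition saturated (nabla : set (set divisor)) : Prop :=
  forall D1 D2 : divisor,
    effective D1 -> effective D2 -> D1 <> zero_divisor -> D2 <> zero_divisor ->
    nabla (div_class (add_divisor D1 D2)) ->
    nabla (div_class D1) /\ nabla (div_class D2).

Definition is_line (L : set vec) : Prop :=
  exists l m : form,
    [/\ l \is 1.-homog, m \is 1.-homog,
        (forall a b : K, a *: l + b *: m = 0 -> a = 0 /\ b = 0)
      & L = zero_locus [set l; m]].

Definition hyperplane_class : set (set divisor) :=
  [set c | exists l : form,
     [/\ l \is 1.-homog, l != 0 & c = div_class (div (of_form l))]].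

(* The lines contained in a smooth quadric surface are exactly the members of
   its two rulings. *)
Definition line_classes : set (set divisor) :=
  [set c | exists2 L : prime_divisor W,
     is_line (sval L) & c = div_class (of_prime L)].

Definition reducible_divisor (D : divisor) : Prop :=
  exists D1 D2 : divisor,
    [/\ effective D1, effective D2, D1 <> zero_divisor, D2 <> zero_divisor
      & D = add_divisor D1 D2].

Definition reducible_member (m : set (vec -> K)) : Prop :=
  exists2 s, m s & reducible_divisor (div s).

Definition component (m : set (vec -> K)) (C : prime_divisor W) : Prop :=
  exists2 s, m s & 0 < div s C.

End Divisors.
End ProjectiveSurface.

Arguments hyperplane_class {K} W.
Arguments line_classes {K} W.

(* Main.v *)
Require Import Defs.
From mathcomp Require Import ring.

(** In coordinates where [W] is [x^2 + y^2 + z^2 + w^2 = 0], take the pencil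
    spanned by [sum e x_e^2] and [sum e^2 x_e^2] with [e] in [{0, 1, 2, 4}].  Modulo
    the equation of [W], a diagonal form with exactly two equal coefficients has
    rank 2, so it cuts [W] in two plane sections, which are smooth conics; with four
    distinct coefficients it cuts [W] in an irreducible quartic curve.  The six sums
    of two distinct [e] are distinct, so each pair of coefficients agrees for exactly
    one member, and these six members are different.

    Irreducibility is proved by norms: the coordinate ring of the quartic is the
    biquadratic extension of [K[x, y]] by square roots [z] and [w] of two binary
    quadratic forms, and that of a conic is a quadratic extension.  Multiplicities
    are bounded by 1 by restricting sections to rational curves on [W] through a
    point where the section has nonzero derivative. *)

Import Order.TTheory GRing.Theory Num.Theory.

Set Implicit Arguments.
Unset Strict Implicit.
Unset Printing Implicit Defensive.

Local Open Scope classical_set_scope.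
Local Open Scope card_scope.
Local Open Scope ring_scope.

(** * Polynomials and nonsquares *)

Section Polynomials.

(** Modulo the equation of [W] all coefficients of a member may be shifted by one constant, so they
    are the values at 0, 1, 2, 4 of a polynomial λ + a t + b t^2. Rank 2 means that two of these
    nodes e, e' are its roots, whence the condition a + (e + e') b = 0. Distinct pair sums make the
    six members different. They also keep the two remaining coefficients distinct; otherwise the two
    planes would be tangent to [W] and cut it in lines instead of smooth conics. The count must be
    exactly six, so every other member has to be irreducible as a divisor: irreducible support and
    multiplicity one. Since [ord] is defined through powers of a vanishing ideal up to a multiplier
    h, the proof only ever separates the orders 0, 1 and at least 2; no additivity of orders is
    established. The class of a conic is read off from the equality of its divisor with that of a
    linear form. *)

Definition nonsquare (B : pzSemiRingType) (p : B) :=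
  forall g e : B, p * g ^+ 2 = e ^+ 2 -> g = 0.

(** The multiplicity of [r] would be odd on the left and even on the right. This is run as a descent
    on the size of [g]: [r] is a root of [e], then of [g], and dividing both by ['X - r%:P] gives a
    smaller solution. *)
Lemma nonsquare_simple_root (A : idomainType) (p : {poly A}) (r : A) :
  ~~ root p r -> nonsquare (('X - r%:P) * p).
Proof.
move=> pr g; have Xr0 : 'X - r%:P != 0 by rewrite polyXsubC_eq0.
have [n] := ubnP (size g); elim: n g => // n IHn g szg e E.
have [->//|g0] := eqVneq g 0.
have re : root e r.
  move/(congr1 (fun q => q.[r])): E; rewrite !(horner_exp, hornerM) hornerXsubC subrr.
  by rewrite !mul0r => /esym/eqP; rewrite expf_eq0.
have [e' De] := factor_theorem _ _ re.
have E1 : p * g ^+ 2 = ('X - r%:P) * e' ^+ 2.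
  apply: (mulfI Xr0); rewrite mulrA E De; ring.
have rg : root g r.
  move/(congr1 (fun q => q.[r])): E1; rewrite !(horner_exp, hornerM) hornerXsubC subrr.
  by rewrite mul0r => /eqP; rewrite mulf_eq0 expf_eq0 /= -rootE (negPf pr).
have [g' Dg] := factor_theorem _ _ rg.
have E2 : ('X - r%:P) * p * g' ^+ 2 = e' ^+ 2.
  apply: (mulfI Xr0); rewrite -E1 Dg; ring.
rewrite Dg (IHn _ _ _ E2) ?mul0r //.
move: szg g0; rewrite Dg; have [->|g'0] := eqVneq g' 0; first by rewrite mul0r eqxx.
by rewrite size_Mmonic ?monicXsubC // size_XsubC addn2.
Qed.

(* The hypothesis says that the norm of a + b z + c w + d z w vanishes, where
   z^2 = q1 and w^2 = q2. *)
Lemma biquadratic_norm_eq0 (B : idomainType) (q1 q2 a b c d : B) :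
  (2%:R : B) != 0 -> nonsquare q1 -> nonsquare q2 -> nonsquare (q1 * q2) ->
  (a ^+ 2 + q1 * b ^+ 2 - q2 * (c ^+ 2 + q1 * d ^+ 2)) ^+ 2 =
    q1 * (2%:R * (a * b - q2 * (c * d))) ^+ 2 ->
  [/\ a = 0, b = 0, c = 0 & d = 0].
Proof.
move=> two0 ns1 ns2 ns12 /esym N0.
have R0 := ns1 _ _ N0.
have P0 : a ^+ 2 + q1 * b ^+ 2 = q2 * (c ^+ 2 + q1 * d ^+ 2).
  apply/eqP; rewrite -subr_eq0; move/esym/eqP: N0.
  by rewrite R0 expr0n mulr0 expf_eq0.
have {}R0 : a * b = q2 * (c * d).
  by apply/eqP; rewrite -subr_eq0; move/eqP: R0; rewrite mulf_eq0 (negPf two0).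
(* With u = a + b z and v = c + d z, the facts so far say u^2 = q2 v^2. Here e + f z is u times the
   conjugate of v, and g is the norm of v, so (e + f z)^2 = q2 g^2. Hence e f = 0, and either case
   makes q2 or q1 q2 a square unless g = 0. *)
pose e := a * c - q1 * b * d; pose f := b * c - a * d; pose g := c ^+ 2 - q1 * d ^+ 2.
have ef0 : e * f = 0.
  have -> : e * f = a * b * (c ^+ 2 + q1 * d ^+ 2) -
                    c * d * (a ^+ 2 + q1 * b ^+ 2) by rewrite /e /f; ring.
  rewrite R0 P0; ring.
have efg : e ^+ 2 + q1 * f ^+ 2 = q2 * g ^+ 2.
  have -> : e ^+ 2 + q1 * f ^+ 2 =
    (a ^+ 2 + q1 * b ^+ 2) * (c ^+ 2 + q1 * d ^+ 2) - 4%:R * q1 * (c * d) * (a * b)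
    by rewrite /e /f; ring.
  rewrite R0 P0 /g; ring.
have g0 : g = 0.
  move/eqP: ef0; rewrite mulf_eq0 => /orP[]/eqP E0; move: efg; rewrite E0 expr0n.
    rewrite add0r => H; apply: (ns12 _ (q1 * f)).
    rewrite -mulrA -H; ring.
  by rewrite mulr0 addr0 => /esym; apply: ns2.
have d0 : d = 0.
  by apply: (ns1 d c); apply/esym/eqP; rewrite -subr_eq0 -/g g0.
have c0 : c = 0.
  by apply/eqP; move/eqP: g0; rewrite /g d0 expr0n mulr0 subr0 expf_eq0.
move: P0; rewrite c0 d0 !expr0n !(mulr0, addr0) => P0.
have b0 : b = 0.
  move: R0; rewrite d0 !mulr0 => /eqP; rewrite mulf_eq0 => /orP[]/eqP // a0.
  apply: (ns1 b 0); move: P0; rewrite a0 !expr0n add0r; exact.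
split => //; move/eqP: P0.
by rewrite b0 expr0n mulr0 addr0 expf_eq0 => /eqP.
Qed.

Lemma poly_eq0_injection (A : idomainType) (p : {poly A}) (f : nat -> A) :
  injective f -> (forall n, p.[f n] = 0) -> p = 0.
Proof.
move=> injf fp; apply/eqP; apply: contraT => p0.
have := @max_poly_roots A p (map f (iota 0 (size p))) p0.
rewrite map_inj_uniq // iota_uniq size_map size_iota ltnn => -> //.
by apply/allP => _ /mapP[n _ ->]; apply/rootP.
Qed.

Variable K : numClosedFieldType.

Lemma natr_inj : injective (fun n : nat => n%:R : K).
Proof. by move=> m n /eqP; rewrite eqr_nat => /eqP. Qed.

Lemma poly_eq0_off (p q : {poly K}) : q != 0 ->
  (forall e, q.[e] != 0 -> p.[e] = 0) -> p = 0.
Proof.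
move=> q0 pq; have : p * q = 0.
  apply: (poly_eq0_injection natr_inj) => n; rewrite hornerM.
  by have [->|/pq->] := eqVneq q.[n%:R] 0; rewrite (mulr0, mul0r).
by move/eqP; rewrite mulf_eq0 (negPf q0) orbF => /eqP.
Qed.

Definition eval2 (p : {poly {poly K}}) (a b : K) : K := p.[a%:P].[b].

(** The values with b = 0 are left out because a pair with b nonzero always lifts to a nonzero
    coordinate vector. *)
Lemma eval2_eq0 (p : {poly {poly K}}) :
  (forall a b, b != 0 -> eval2 p a b = 0) -> p = 0.
Proof.
move=> p0; apply: (@poly_eq0_injection _ _ (fun n : nat => (n%:R : K)%:P)).
  by move=> m n /polyC_inj/natr_inj.
move=> n; apply: (@poly_eq0_off _ 'X); first by rewrite polyX_eq0.
by move=> e; rewrite hornerX => e0; apply: p0.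
Qed.

Lemma eval2C c a b : eval2 c%:P%:P a b = c.
Proof. by rewrite /eval2 !hornerE. Qed.
Lemma eval2_0 a b : eval2 0 a b = 0.
Proof. by rewrite /eval2 !horner0. Qed.
Lemma eval2_nat n a b : eval2 n%:R a b = n%:R.
Proof. by rewrite -!polyC_natr eval2C. Qed.
Lemma eval2X a b : eval2 'X a b = a.
Proof. by rewrite /eval2 !hornerE. Qed.
Lemma eval2Y a b : eval2 'X%:P a b = b.
Proof. by rewrite /eval2 !hornerE. Qed.
Lemma eval2D p q a b : eval2 (p + q) a b = eval2 p a b + eval2 q a b.
Proof. by rewrite /eval2 !hornerE. Qed.
Lemma eval2N p a b : eval2 (- p) a b = - eval2 p a b.
Proof. by rewrite /eval2 !hornerE. Qed.
Lemma eval2M p q a b : eval2 (p * q) a b = eval2 p a b * eval2 q a b.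
Proof. by rewrite /eval2 !hornerE. Qed.
Lemma eval2_exp p n a b : eval2 (p ^+ n) a b = eval2 p a b ^+ n.
Proof. by rewrite /eval2 !hornerE. Qed.

Definition eval2E := (eval2D, eval2N, eval2M, eval2_exp, eval2C, eval2X, eval2Y,
  eval2_0, eval2_nat).

Definition binary (a b : K) : {poly {poly K}} :=
  a%:P%:P * 'X ^+ 2 + b%:P%:P * 'X%:P ^+ 2.

Lemma binary_factor (a b : K) : a != 0 ->
  let k := sqrtC (- b / a) in
  binary a b = ('X - (k *: 'X)%:P) * (a%:P%:P * ('X + (k *: 'X)%:P)).
Proof.
move=> a0 k.
have -> : b = - a * k ^+ 2 by rewrite sqrtCK; field.
rewrite /binary -!mul_polyC !(polyCM, polyCN, polyC_exp); ring.
Qed.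

Lemma binary_nonsquare (a b : K) : a != 0 -> b != 0 -> nonsquare (binary a b).
Proof.
move=> a0 b0; rewrite binary_factor //; apply: nonsquare_simple_root.
have k0 : sqrtC (- b / a) != 0 by rewrite sqrtC_eq0 mulf_neq0 ?oppr_eq0 ?invr_eq0.
rewrite /root !hornerE -scalerDl mulf_neq0 ?polyC_eq0 // scaler_eq0 polyX_eq0 orbF.
by rewrite -mulr2n mulrn_eq0.
Qed.

(** Writing y for the inner variable, the root k y of the first form is simple, and it is no root of
    the second, whose value there is (a d - b c) / a times y^2. *)
Lemma binary_mul_nonsquare (a b c d : K) :
  a != 0 -> b != 0 -> a * d != b * c -> nonsquare (binary a b * binary c d).
Proof.
move=> a0 b0 abcd; rewrite binary_factor // -mulrA; apply: nonsquare_simple_root.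
set k := sqrtC _.
have k0 : k != 0 by rewrite sqrtC_eq0 mulf_neq0 ?oppr_eq0 ?invr_eq0.
rewrite rootM negb_or; apply/andP; split.
  rewrite /root !hornerE -scalerDl mulf_neq0 ?polyC_eq0 // scaler_eq0 polyX_eq0 orbF.
  by rewrite -mulr2n mulrn_eq0.
have -> : root (binary c d) (k *: 'X) = (((a * d - b * c) / a) *: 'X^2 == 0 :> {poly K}).
  rewrite /root /binary !(hornerD, horner_exp, hornerM, hornerC, hornerX).
  congr (_ == _); rewrite -!mul_polyC exprMn -polyC_exp sqrtCK mulrA -polyCM.
  by rewrite -mulrDl -polyCD; congr (_%:P * _); field.
by rewrite scaler_eq0 expf_eq0 polyX_eq0 !mulf_eq0 invr_eq0 subr_eq0 (negPf a0)
  (negPf abcd).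
Qed.

End Polynomials.

(** * Ideals of closed cones *)

Section Forms.
Variable K : numClosedFieldType.
Notation form := {mpoly K[4]}.
Notation vec := (vec K).
Implicit Types (F G : form) (u v : vec) (S C W : set vec).

Definition generators (x y z w : form) : Prop :=
  forall i, exists a b c d, 'X_i = a *: x + b *: y + c *: z + d *: w.

(** This stands in for a linear change of variables: normal forms are built by induction on
    expressions in the adapted coordinates. *)
Lemma generators_ind (x y z w : form) (P : form -> Prop) :
  generators x y z w ->
  (forall c, P c%:MP) -> (forall F G, P F -> P G -> P (F + G)) ->
  (forall F G, P F -> P G -> P (F * G)) -> P x -> P y -> P z -> P w ->
  forall F, P F.
Proof.
move=> gen PC PD PM Px Py Pz Pw.
have PZ c F : P F -> P (c *: F) by move=> PF; rewrite -mul_mpolyC; apply: PM.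
have PX i : P 'X_i.
  have [a [b [c [d ->]]]] := gen i.
  exact: PD (PD _ _ (PD _ _ (PZ _ _ Px) (PZ _ _ Py)) (PZ _ _ Pz)) (PZ _ _ Pw).
have PXm m : P 'X_[m].
  rewrite mpolyXE_id; apply: big_ind => [|//|i _]; first exact: PC 1.
  elim: (m i) => [|k IHk]; first exact: PC 1.
  by rewrite exprS; apply: PM.
elim/mpolyind => [|c m F _ _ PF]; first by rewrite -mpolyC0.
by apply: PD => //; apply: PZ.
Qed.

Lemma meval_homogZ d F c v : F \is d.-homog ->
  F.@[fun i => c * v i] = c ^+ d * F.@[v].
Proof.
move=> /dhomogP hF; rewrite !mevalE mulr_sumr; apply: eq_big_seq => m /hF <-.
under eq_bigr do rewrite exprMn.
by rewrite big_split /= prodrXr -mdegE; ring.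
Qed.

Lemma meval_linear F a b u v : F \is 1.-homog ->
  F.@[fun i => a * u i + b * v i] = a * F.@[u] + b * F.@[v].
Proof.
move=> /dhomogP hF; rewrite !mevalE !mulr_sumr -big_split.
apply: eq_big_seq => m /hF /eqP/mdeg1P[i /eqP ->].
have E (f : vec) : \prod_j f j ^+ U_(i)%MM j = f i.
  by rewrite -[RHS](mevalXU f i) mevalX.
by rewrite !E /=; ring.
Qed.

Definition prime_on S : Prop := forall F G,
  (forall v, S v -> F.@[v] * G.@[v] = 0) ->
  vanishing_ideal S F \/ vanishing_ideal S G.

(** If some [F] cutting out the first closed set is nonzero somewhere on [S], then each [G] cutting
    out the second has [F * G] zero on [S], hence vanishes on [S]. *)
Lemma prime_on_irreducible S :
  S !=set0 -> (forall v, S v -> exists i, v i != 0) -> prime_on S ->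
  zariski_irreducible S.
Proof.
move=> S0 Snz pS; split=> // _ _ [A [_ ->]] [B [_ ->]] SAB.
have [|/existsNP[v /not_implyP[Sv nAv]]] := pselect (S `<=` zero_locus A); first by left.
right => v' Sv'; split; first exact: Snz.
move=> G BG; have [F [AF Fv]] : exists F, A F /\ F.@[v] != 0.
  apply: contrapT => nF; apply: nAv; split; first exact: Snz.
  by move=> F AF; apply/eqP/negPn/negP => Fv; apply: nF; exists F.
have [||/(_ _ Sv') //] := pS F G; last by move=> /(_ _ Sv)/eqP; rewrite (negPf Fv).
move=> u Su; case: (SAB _ Su) => [[_ /(_ _ AF) ->]|[_ /(_ _ BG) ->]];
  by rewrite (mul0r, mulr0).
Qed.

Lemma closed_scale C c v : zariski_closed C -> C v -> c != 0 -> C (fun i => c * v i).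
Proof.
move=> [A [homA ->]] [[i vi] Av] c0; split; first by exists i; rewrite mulf_neq0.
by move=> F AF; have [d hF] := homA _ AF; rewrite (meval_homogZ _ _ hF) Av // mulr0.
Qed.

(** The restriction of [F] to the line spanned by [v]. Its coefficients are the values at [v] of the
    homogeneous components, so identities valid on a cone split by degree. *)
Definition homog_poly F v : {poly K} :=
  \poly_(e < msize F) (pihomog mdeg e F).@[v].

Lemma horner_homog_poly F v c : (homog_poly F v).[c] = F.@[fun i => c * v i].
Proof.
rewrite horner_poly [in RHS](@pihomog_partitionE _ _ mdeg (msize F) F) //.
rewrite (raddf_sum (meval (fun i => c * v i))); apply: eq_bigr => e _ /=.
by rewrite (@meval_homogZ e) ?pihomogP // mulrC.
Qed.

Lemma coef_homog_poly F v e : (homog_poly F v)`_e = (pihomog mdeg e F).@[v].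
Proof.
rewrite coef_poly; case: ifP => // /negbT; rewrite -leqNgt => le.
rewrite pihomogE big_seq_cond big_pred0 ?meval0 // => m.
apply/negP => /andP[/msize_mdeg_lt + /eqP me]; rewrite me => /leq_trans /(_ le).
by rewrite ltnn.
Qed.

(** Irreducibility speaks of sets cut out by homogeneous forms, whereas the multiplier [h] of an
    order of vanishing is arbitrary. So [h] is replaced by its components: where [F] is nonzero, [h]
    vanishes on the whole line through the point, hence so does each component. *)
Lemma irreducible_mul_form C h d F :
  zariski_closed C -> zariski_irreducible C -> F \is d.-homog ->
  ~ vanishing_ideal C h -> (forall v, C v -> h.@[v] * F.@[v] = 0) ->
  vanishing_ideal C F.
Proof.
move=> cC [_ iC] hF nh hF0.
have [A [homA CE]] := cC.
have Cnz v : C v -> exists i, v i != 0 by rewrite CE => -[].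
pose H := [set G | exists e, G = pihomog mdeg e h].
have [| | |sub|sub] := iC (zero_locus [set F]) (zero_locus H).
- by exists [set F]; split=> // _ ->; exists d.
- by exists H; split=> // _ [e ->]; exists e; apply: pihomogP.
- move=> v Cv; have [Fv|Fv] := eqVneq F.@[v] 0.
    by left; split; [exact: Cnz | move=> _ ->].
  right; split; first exact: Cnz.
  move=> _ [e ->].
  have p0 : homog_poly h v = 0.
    apply: (@poly_eq0_off _ _ 'X); first by rewrite polyX_eq0.
    move=> c; rewrite hornerX horner_homog_poly => c0.
    move/eqP: (hF0 _ (closed_scale cC Cv c0)).
    rewrite (meval_homogZ _ _ hF) !mulf_eq0 expf_eq0 (negPf c0) andbF (negPf Fv).
    by rewrite !orbF => /eqP.
  by rewrite -coef_homog_poly p0 coef0.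
- by move=> v /sub[_]; apply.
- case: nh => v Cv; have [_ Hv] := sub _ Cv.
  rewrite (@pihomog_partitionE _ _ mdeg (msize h) h) // (raddf_sum (meval v)).
  by apply: big1 => e _; apply: Hv; exists e.
Qed.

End Forms.

(** * Orders of vanishing and frames *)

Section Order.
Variable K : numClosedFieldType.
Notation form := {mpoly K[4]}.
Notation vec := (vec K).
Implicit Types (F G : form) (u v : vec) (S C W : set vec) (s t : vec -> K).

Lemma ideal_pow_decr (I : set form) n : ideal_pow I n.+1 `<=` ideal_pow I n.
Proof.
elim: n => [//|n IHn] F [s [sI ->]]; exists s; split=> // ab /sI[Ia Ib].
by split=> //; apply: IHn.
Qed.

Lemma ideal_pow_vanishing C n F :
  ideal_pow (vanishing_ideal C) n.+1 F -> vanishing_ideal C F.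
Proof.
move=> [s [sI ->]] v Cv; rewrite (raddf_sum (meval v)) big_seq big1 //= => ab.
by move=> /sI[+ _] => /(_ _ Cv); rewrite mevalM => ->; rewrite mul0r.
Qed.

Lemma vanishing_ideal_pow1 C F :
  vanishing_ideal C F -> ideal_pow (vanishing_ideal C) 1 F.
Proof.
move=> CF; exists [:: (F, 1)]; split; first by move=> ab; rewrite inE => /eqP ->.
by rewrite big_seq1 mulr1.
Qed.

Lemma vanishes_to_order_le W C m n s :
  (m <= n)%N -> vanishes_to_order W C n s -> vanishes_to_order W C m s.
Proof.
move=> /subnKC <-; elim: (n - m)%N => [|k IHk]; first by rewrite addn0.
by rewrite addnS => -[h [G [hC /ideal_pow_decr GI hG]]]; apply: IHk; exists h, G.
Qed.

Lemma vanishes_to_order_scale W C n s t (c : K) : c != 0 ->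
  (forall v, W v -> t v = c * s v) ->
  vanishes_to_order W C n t -> vanishes_to_order W C n s.
Proof.
move=> c0 ts [h [G [hC GI hG]]]; exists (c *: h), G; split=> //.
  apply: contra_not hC => ch v /ch/eqP.
  by rewrite mevalZ mulf_eq0 (negPf c0) => /eqP.
by move=> v Wv; rewrite -hG // ts // mevalZ; ring.
Qed.

Lemma ord_scale W C s t (c : K) : c != 0 ->
  (forall v, W v -> t v = c * s v) -> ord W C t = ord W C s.
Proof.
move=> c0 ts; have st v : W v -> s v = c^-1 * t v by move=> /ts ->; rewrite mulKf.
congr (xget _ _); apply/predeqP => n; split=> -[H nH].
  split; first exact: vanishes_to_order_scale c0 ts H.
  by apply: contra_not nH; apply: (vanishes_to_order_scale _ st); rewrite invr_neq0.
split; first by apply: (vanishes_to_order_scale _ st); rewrite ?invr_neq0.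
by apply: contra_not nH; apply: vanishes_to_order_scale c0 ts.
Qed.

Lemma ord_gt0 W C s : (0 < ord W C s)%N -> vanishes_to_order W C 1 s.
Proof.
rewrite /ord; case: xgetP => [n _ [Hn _] n0|//].
exact: vanishes_to_order_le Hn.
Qed.

Lemma ord_le1 W C s : ~ vanishes_to_order W C 2 s -> (ord W C s <= 1)%N.
Proof.
(* If no exact order exists, [ord] is its default 0 and the bound holds as well. *)
move=> n2; rewrite /ord; case: xgetP => [n _ [Hn _]|//].
rewrite leqNgt; apply/negP => n1; apply: n2; exact: vanishes_to_order_le Hn.
Qed.

Lemma ord_eq1 W C s : vanishes_to_order W C 1 s -> ~ vanishes_to_order W C 2 s ->
  ord W C s = 1%N.
Proof.
move=> H1 H2; apply/eqP; rewrite eqn_leq ord_le1 //= lt0n; apply/eqP.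
rewrite /ord; case: xgetP => [n -> [_ +] n0|/(_ 1%N) []]; last by [].
by rewrite n0.
Qed.

Lemma vanishes_to_order1_form W C F : C !=set0 -> vanishing_ideal C F ->
  vanishes_to_order W C 1 (of_form F).
Proof.
move=> [v Cv] CF; exists 1, F; split; last by move=> u _; rewrite meval1 mul1r.
  by move=> /(_ _ Cv)/eqP; rewrite meval1 oner_eq0.
exact: vanishing_ideal_pow1.
Qed.

Lemma ord_gt0_vanishing W C d F : C `<=` W ->
  zariski_closed C -> zariski_irreducible C -> F \is d.-homog ->
  (0 < ord W C (of_form F))%N -> vanishing_ideal C F.
Proof.
move=> CW cC iC hF /ord_gt0[h [G [hC /ideal_pow_vanishing GC hG]]].
apply: (irreducible_mul_form cC iC hF hC) => v Cv.
by rewrite -[F.@[v]]/(of_form F v) hG ?GC //; apply: CW.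
Qed.

Definition along (p : 'I_4 -> {poly K}) F : {poly K} := mmap (@polyC K) p F.

Lemma horner_along p F e : (along p F).[e] = F.@[fun i => (p i).[e]].
Proof.
rewrite mevalE /along /mmap horner_sum; apply: eq_bigr => m _.
rewrite hornerM hornerC horner_prod; congr (_ * _).
by apply: eq_bigr => i _; rewrite horner_exp.
Qed.

Lemma poly_horner_inj (p q : {poly K}) : (forall e, p.[e] = q.[e]) -> p = q.
Proof.
move=> pq; apply/eqP; rewrite -subr_eq0; apply/eqP.
apply: (@poly_eq0_off _ _ 1); first exact: oner_neq0.
by move=> e _; rewrite hornerD hornerN pq subrr.
Qed.

(** The curve meets [C] at parameter 0, so a form vanishing on [C] pulls back to a multiple of the
    parameter, and a product of two such forms to a multiple of its square. *)
Lemma along_ideal_pow2 C G (p : 'I_4 -> {poly K}) : C (fun i => (p i).[0]) ->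
  ideal_pow (vanishing_ideal C) 2 G -> exists T, along p G = 'X^2 * T.
Proof.
move=> Cp [s [sI ->]]; elim: s sI => [|[a b] s IHs] sI.
  by exists 0; apply: poly_horner_inj => e; rewrite horner_along big_nil meval0 mulr0 horner0.
have [|T ET] := IHs; first by move=> ab abs; apply: sI; rewrite inE abs orbT.
have [aC bI] := sI (a, b) (mem_head _ _).
have div F : vanishing_ideal C F -> exists A, along p F = A * 'X.
  move=> FC; have [|A ->] := factor_theorem (along p F) 0 _; last first.
    by exists A; rewrite subr0.
  by apply/rootP; rewrite horner_along FC.
have [[A EA] [B EB]] := (div _ aC, div _ (@ideal_pow_vanishing C 0 b bI)).
exists (A * B + T); apply: poly_horner_inj => e; rewrite horner_along big_cons.
rewrite mevalD mevalM -!horner_along EA EB ET /=.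
by rewrite !(hornerD, hornerM, horner_exp, hornerX); ring.
Qed.

End Order.

(** * Coordinates in which the quadric is a sum of four squares, and transversality *)

Section Frames.
Variable K : numClosedFieldType.
Notation form := {mpoly K[4]}.
Notation vec := (vec K).
Implicit Types (F G : form) (t u v : vec) (C W : set vec).

(** [frame_gen] and [frame_surj] are the two halves of being a basis of the linear forms: spanning
    and independence. *)
Record frame W (x y z w : form) : Prop := Frame {
  frame_homog : [/\ x \is 1.-homog, y \is 1.-homog, z \is 1.-homog & w \is 1.-homog];
  frame_gen : generators x y z w;
  frame_surj : forall a b c d, exists v,
    [/\ x.@[v] = a, y.@[v] = b, z.@[v] = c & w.@[v] = d];
  frame_quadric : W = zero_locus [set x ^+ 2 + y ^+ 2 + z ^+ 2 + w ^+ 2] }.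

Section OneFrame.
Variables (W : set vec) (x y z w : form).
Hypothesis fW : frame W x y z w.

Lemma quadricE v : W v <-> (exists i, v i != 0) /\
  x.@[v] ^+ 2 + y.@[v] ^+ 2 + z.@[v] ^+ 2 + w.@[v] ^+ 2 = 0.
Proof.
rewrite (frame_quadric fW); split=> -[v0 Hv]; split=> //.
  by have := Hv _ erefl; rewrite !(mevalD, rmorphXn).
by move=> _ ->; rewrite !(mevalD, rmorphXn).
Qed.

Lemma frame_neq0 v : (exists i, v i != 0) <->
  [|| x.@[v] != 0, y.@[v] != 0, z.@[v] != 0 | w.@[v] != 0].
Proof.
split.
  case=> i; apply: contraNT; rewrite !negb_or !negbK.
  move=> /and4P[/eqP vx /eqP vy /eqP vz /eqP vw].
  have [a [b [c [d E]]]] := frame_gen fW i.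
  by rewrite -(mevalXU v i) E !(mevalD, mevalZ) vx vy vz vw !mulr0 !addr0.
move=> H; apply: contrapT => /forallNP v0.
have {}v0 : v = fun i => 0 * v i + 0 * v i.
  by apply/funext => i; rewrite !mul0r addr0; apply/eqP/negPn/negP/v0.
move: H; have [hx hy hz hw] := frame_homog fW.
by rewrite v0 !meval_linear // !mul0r !addr0 eqxx.
Qed.

Definition dot u v := x.@[u] * x.@[v] + y.@[u] * y.@[v] + z.@[u] * z.@[v] + w.@[u] * w.@[v].

(** The isotropic lines of the plane are spanned by (1, i) and (1, -i), and a nonzero vector cannot
    be orthogonal to both. *)
Lemma isotropic_pair (a b : K) : (a != 0) || (b != 0) ->
  exists a' b', a' ^+ 2 + b' ^+ 2 = 0 /\ a * a' + b * b' = 1.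
Proof.
move=> ab; have [|] := boolP (a + 'i * b != 0).
  exists (a + 'i * b)^-1, ('i / (a + 'i * b)); split.
    by rewrite exprMn sqrCi; ring.
  by field.
rewrite negbK => /eqP E; have E' : a - 'i * b != 0.
  apply: contraL ab => /eqP E'; rewrite negb_or !negbK.
  have : 2%:R * a = 0 by rewrite -[RHS](addr0 0) -{1}E -E'; ring.
  have : 2%:R * 'i * b = 0 by rewrite -[RHS](subrr 0) -{1}E -E'; ring.
  by move=> /eqP + /eqP; rewrite !mulf_eq0 (negPf (neq0Ci _)) pnatr_eq0 /= => -> ->.
exists (a - 'i * b)^-1, (- 'i / (a - 'i * b)); split.
  by rewrite exprMn sqrrN sqrCi; ring.
by field.
Qed.

Lemma isotropic_dual v : (exists i, v i != 0) -> exists u, dot u u = 0 /\ dot v u = 1.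
Proof.
move=> /frame_neq0 v0.
have [/isotropic_pair[a [b [E1 E2]]]|] := boolP ((x.@[v] != 0) || (y.@[v] != 0)).
  have [u [ux uy uz uw]] := frame_surj fW a b 0 0; exists u.
  by rewrite /dot ux uy uz uw !mulr0 !addr0 -!expr2.
rewrite negb_or => /andP[/negPf x0 /negPf y0]; move: v0; rewrite x0 y0 /=.
move=> /isotropic_pair[a [b [E1 E2]]].
have [u [ux uy uz uw]] := frame_surj fW 0 0 a b; exists u.
by rewrite /dot ux uy uz uw !mulr0 !add0r -!expr2.
Qed.

(* The section has nonzero derivative at v in the direction t, tangent to the
   quadric.  The derivative is read off on any curve of the given form, since
   such curves can be chosen on the quadric. *)
Definition transverse F : Prop := forall v, W v -> F.@[v] = 0 -> exists t,
  dot v t = 0 /\ forall g k u, exists2 T : {poly K}, T.[0] != 0 &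
    forall e, F.@[fun i => (1 + g * e) * (v i + e * t i) - e ^+ 2 * k * u i] = e * T.[e].

(** At a point of [C] where the multiplier [h] is nonzero, [F] is restricted to a curve on [W] with
    the transverse tangent direction. Order 2 would make the restriction of [h * F] divisible by the
    square of the parameter, although it vanishes exactly once at 0. *)
Lemma transverse_order C F : transverse F -> C `<=` W -> vanishing_ideal C F ->
  ~ vanishes_to_order W C 2 (of_form F).
Proof.
move=> tF CW CF [h [G [hC GI hG]]].
have [v Cv hv] : exists2 v, C v & h.@[v] != 0.
  apply: contrapT => nv; apply: hC => v Cv; apply/eqP/negPn/negP => hv.
  by apply: nv; exists v.
have Wv := CW _ Cv; have [v0 Ev] := (quadricE v).1 Wv.
have [t [vt HT]] := tF v Wv (CF _ Cv).
have [u [uu vu]] := isotropic_dual v0.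
have [g Eg] : exists g, dot t u = g by exists (dot t u).
have [k Ek] : exists k, dot t t = 2%:R * k by exists (dot t t / 2%:R); field.
have [T T0 ET] := HT g k u.
(* The tangent line v + e t is projected from the isotropic point u: p(e) is the second intersection
   with [W] of the line joining v + e t to u. The values of g and k are forced by that equation. *)
pose p i : {poly K} := (1 + g *: 'X) * ((v i)%:P + t i *: 'X) - (k * u i) *: 'X^2.
have pe e : (fun i => (p i).[e]) =
    fun i => (1 + g * e) * (v i + e * t i) - e ^+ 2 * k * u i.
  apply/funext => i; rewrite /p.
  by rewrite !(hornerD, hornerN, hornerM, hornerZ, hornerC, hornerXn, hornerX); ring.
have p0 : (fun i => (p i).[0]) = v.
  by rewrite pe; apply/funext => i; ring.
have lin F' e : F' \is 1.-homog -> F'.@[fun i => (p i).[e]] =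
    (1 + g * e) * (F'.@[v] + e * F'.@[t]) - e ^+ 2 * k * F'.@[u].
  move=> hF'; rewrite pe.
  have -> : (fun i => (1 + g * e) * (v i + e * t i) - e ^+ 2 * k * u i) =
    (fun i => 1 * ((1 + g * e) * v i + ((1 + g * e) * e) * t i) + (- e ^+ 2 * k) * u i).
    by apply/funext => i; ring.
  by rewrite !meval_linear //; ring.
have [hx hy hz hw] := frame_homog fW.
(* The product with u is (1 + g e)^2, so the curve can pass through the zero vector only where 1 + g
   e = 0. One excluded value does not affect the polynomial identity below. *)
have Wp e : 1 + g * e != 0 -> W (fun i => (p i).[e]).
  move=> ge; apply/quadricE; split.
    apply/frame_neq0; apply: contraT; rewrite !negb_or !negbK.
    move=> /and4P[/eqP px /eqP py /eqP pz /eqP pw].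
    have : dot (fun i => (p i).[e]) u = 0 by rewrite /dot px py pz pw; ring.
    have -> : dot (fun i => (p i).[e]) u =
      (1 + g * e) * (dot v u + e * dot t u) - e ^+ 2 * k * dot u u.
      by rewrite /dot !lin //; ring.
    by rewrite uu vu Eg mulr0 subr0 [e * g]mulrC => /eqP; rewrite mulf_eq0 (negPf ge).
  have -> : x.@[fun i => (p i).[e]] ^+ 2 + y.@[fun i => (p i).[e]] ^+ 2
     + z.@[fun i => (p i).[e]] ^+ 2 + w.@[fun i => (p i).[e]] ^+ 2 =
    (1 + g * e) ^+ 2 * (dot v v + 2%:R * e * dot v t + e ^+ 2 * dot t t)
    - 2%:R * (1 + g * e) * e ^+ 2 * k * (dot v u + e * dot t u)
    + e ^+ 4 * k ^+ 2 * dot u u.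
    by rewrite /dot !lin //; ring.
  have -> : dot v v = 0 by rewrite /dot -Ev; ring.
  by rewrite vt uu vu Eg Ek; ring.
have [A EG] : exists A, along p G = 'X^2 * A.
  by apply: along_ideal_pow2 GI; rewrite p0.
have E : along p h * ('X * T) - 'X^2 * A = 0.
  apply: (@poly_eq0_off _ _ (1 + g *: 'X)).
    apply/eqP => /(congr1 (fun q : {poly K} => q.[0]))/eqP.
    by rewrite !hornerE ?mulr0 ?addr0 oner_eq0.
  move=> e; have -> : (1 + g *: 'X).[e] = 1 + g * e by rewrite !hornerE.
  move=> ge; have := hG _ (Wp _ ge).
  have -> : of_form F (fun i => (p i).[e]) = e * T.[e] by rewrite /of_form pe ET.
  rewrite -!horner_along EG !(hornerD, hornerN, hornerM, hornerXn, hornerX) => ->.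
  by rewrite subrr.
have E1 : along p h * T = 'X * A.
  have X0 : 'X != 0 :> {poly K} by rewrite polyX_eq0.
  apply: (mulfI X0); apply/eqP; rewrite -subr_eq0 -E; apply/eqP; ring.
move/(congr1 (fun q : {poly K} => q.[0]))/eqP: E1.
by rewrite !hornerM hornerX mul0r horner_along p0 mulf_eq0 (negPf hv) (negPf T0).
Qed.

End OneFrame.
End Frames.

(** * Quartic curves: the prime ideal *)

Section Irreducibility.
Variable K : numClosedFieldType.
Notation form := {mpoly K[4]}.
Notation vec := (vec K).
Implicit Types (F G : form) (t u v : vec) (W : set vec).
Variables (x y z w : form).
Hypothesis gen : generators x y z w.

Section Biquadratic.
Variables (S : set vec) (a b c d : K).
Hypotheses (a0 : a != 0) (b0 : b != 0) (c0 : c != 0) (d0 : d != 0).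
Hypothesis abcd : a * d != b * c.
Hypothesis Sz : forall v, S v -> z.@[v] ^+ 2 = a * x.@[v] ^+ 2 + b * y.@[v] ^+ 2.
Hypothesis Sw : forall v, S v -> w.@[v] ^+ 2 = c * x.@[v] ^+ 2 + d * y.@[v] ^+ 2.
Hypothesis Slift : forall x0 y0 z0 w0 : K, y0 != 0 ->
  z0 ^+ 2 = a * x0 ^+ 2 + b * y0 ^+ 2 -> w0 ^+ 2 = c * x0 ^+ 2 + d * y0 ^+ 2 ->
  exists v, [/\ S v, x.@[v] = x0, y.@[v] = y0, z.@[v] = z0 & w.@[v] = w0].

(** The functions 1, z, w, z w span the coordinate ring of [S] over K[x, y], since z^2 and w^2 are
    binary forms in x and y. *)
Lemma biquadratic_normal_form F : exists A B C D : {poly {poly K}}, forall v, S v ->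
  F.@[v] = eval2 A x.@[v] y.@[v] + eval2 B x.@[v] y.@[v] * z.@[v]
    + eval2 C x.@[v] y.@[v] * w.@[v] + eval2 D x.@[v] y.@[v] * z.@[v] * w.@[v].
Proof.
move: F; apply: (generators_ind gen) => [k|F G [A [B [C [D E]]]] [A' [B' [C' [D' E']]]]
  |F G [A [B [C [D E]]]] [A' [B' [C' [D' E']]]]| | | |].
- by exists k%:P%:P, 0, 0, 0 => v _; rewrite mevalC !eval2E; ring.
- exists (A + A'), (B + B'), (C + C'), (D + D') => v Sv.
  by rewrite mevalD E // E' // !eval2E; ring.
- pose q1 := binary a b; pose q2 := binary c d.
  exists (A * A' + q1 * (B * B') + q2 * (C * C') + q1 * q2 * (D * D')),
    (A * B' + B * A' + q2 * (C * D' + D * C')),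
    (A * C' + C * A' + q1 * (B * D' + D * B')),
    (A * D' + D * A' + B * C' + C * B') => v Sv.
  rewrite mevalM E // E' // /q1 /q2 /binary !eval2E -Sz // -Sw //; ring.
- by exists 'X, 0, 0, 0 => v _; rewrite !eval2E; ring.
- by exists 'X%:P, 0, 0, 0 => v _; rewrite !eval2E; ring.
- by exists 0, 1, 0, 0 => v _; rewrite !(eval2_nat 1) !eval2E; ring.
- by exists 0, 0, 1, 0 => v _; rewrite !(eval2_nat 1) !eval2E; ring.
Qed.

(** Over each (s, t) with t nonzero the four points with coordinates ±z0, ±w0 lie on [S], so the
    product of the norms of [F] and [G] is the zero polynomial. One norm is then zero, which kills
    all four coefficients of its normal form. *)
Lemma biquadratic_prime : prime_on S.
Proof.
move=> F G FG0.
have [A [B [C [D E]]]] := biquadratic_normal_form F.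
have [A' [B' [C' [D' E']]]] := biquadratic_normal_form G.
pose q1 := binary a b; pose q2 := binary c d.
pose N (A B C D : {poly {poly K}}) :=
  (A ^+ 2 + q1 * B ^+ 2 - q2 * (C ^+ 2 + q1 * D ^+ 2)) ^+ 2 -
  q1 * (2%:R * (A * B - q2 * (C * D))) ^+ 2.
(* The norm is the product of the conjugates under [z -> -z] and [w -> -w]. *)
have NN0 : N A B C D * N A' B' C' D' = 0.
  apply: eval2_eq0 => s t t0.
  pose z0 := sqrtC (a * s ^+ 2 + b * t ^+ 2).
  pose w0 := sqrtC (c * s ^+ 2 + d * t ^+ 2).
  have Ez : z0 ^+ 2 = a * s ^+ 2 + b * t ^+ 2 by exact: sqrtCK.
  have Ew : w0 ^+ 2 = c * s ^+ 2 + d * t ^+ 2 by exact: sqrtCK.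
  pose val (A B C D : {poly {poly K}}) (z0 w0 : K) := eval2 A s t + eval2 B s t * z0
    + eval2 C s t * w0 + eval2 D s t * z0 * w0.
  have NE A1 B1 C1 D1 : eval2 (N A1 B1 C1 D1) s t =
      val A1 B1 C1 D1 z0 w0 * val A1 B1 C1 D1 (- z0) w0 * val A1 B1 C1 D1 z0 (- w0) *
      val A1 B1 C1 D1 (- z0) (- w0).
    rewrite /N /q1 /q2 /binary.
    rewrite !eval2E -Ez -Ew /val; ring.
  have val0 z1 w1 : z1 ^+ 2 = z0 ^+ 2 -> w1 ^+ 2 = w0 ^+ 2 ->
      val A B C D z1 w1 * val A' B' C' D' z1 w1 = 0.
    rewrite Ez Ew => Ez1 Ew1; have [v [Sv vx vy vz vw]] := Slift t0 Ez1 Ew1.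
    by have := FG0 _ Sv; rewrite E // E' // vx vy vz vw.
  rewrite eval2M !NE; set f := val A B C D; set g := val A' B' C' D'.
  have -> : f z0 w0 * f (- z0) w0 * f z0 (- w0) * f (- z0) (- w0) *
     (g z0 w0 * g (- z0) w0 * g z0 (- w0) * g (- z0) (- w0)) =
    (f z0 w0 * g z0 w0) * (f (- z0) w0 * g (- z0) w0) *
    ((f z0 (- w0) * g z0 (- w0)) * (f (- z0) (- w0) * g (- z0) (- w0))) by ring.
  by rewrite /f /g !val0 ?sqrrN // !mul0r.
have N0 A1 B1 C1 D1 : N A1 B1 C1 D1 = 0 -> [/\ A1 = 0, B1 = 0, C1 = 0 & D1 = 0].
  move=> /eqP; rewrite subr_eq0 => /eqP.
  apply: biquadratic_norm_eq0.
  - by rewrite -!polyC_natr !polyC_eq0 pnatr_eq0.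
  - exact: binary_nonsquare.
  - exact: binary_nonsquare.
  - exact: binary_mul_nonsquare.
move/eqP: NN0; rewrite mulf_eq0 => /orP[]/eqP/N0[EA EB EC ED]; [left|right] => v Sv.
  by rewrite E // EA EB EC ED !eval2E; ring.
by rewrite E' // EA EB EC ED !eval2E; ring.
Qed.

End Biquadratic.

End Irreducibility.

(** * Plane sections *)

Section Conics.
Variable K : numClosedFieldType.
Notation form := {mpoly K[4]}.
Notation vec := (vec K).
Implicit Types (F G : form) (u v : vec).

Lemma closed_proper_form (W Y : set vec) : zariski_closed Y ->
  ~ W `<=` Y -> (forall v, W v -> exists i, v i != 0) ->
  exists d F, [/\ F \is d.-homog, vanishing_ideal Y F & ~ vanishing_ideal W F].
Proof.
move=> [A [homA ->]] nWY W0; apply: contrapT => nF; apply: nWY => v Wv.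
split; first exact: W0.
move=> F AF; have [d hF] := homA _ AF; apply: contrapT => Fv; apply: nF.
by exists d, F; split=> [//|u [_ /(_ _ AF)]|/(_ _ Wv)].
Qed.

Section OneConic.
Variables (W : set vec) (x y z w : form).
Hypothesis fW : frame W x y z w.

Definition conic : set vec := [set v | W v /\ w.@[v] = 0].

(* [A] and [B] are the polynomials [a] and [b] as forms, which are needed to
   multiply normal forms. *)
Lemma conic_normal_form F : exists F1 A B (a b : {poly {poly K}}),
  [/\ forall v, A.@[v] = eval2 a x.@[v] y.@[v],
      forall v, B.@[v] = eval2 b x.@[v] y.@[v] &
      forall v, W v -> F.@[v] = w.@[v] * F1.@[v] + A.@[v] + B.@[v] * z.@[v]].
Proof.
move: F; apply: (generators_ind (frame_gen fW)) =>
  [k|F G [F1 [A [B [a [b [EA EB E]]]]]] [G1 [A' [B' [a' [b' [EA' EB' E']]]]]]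
  |F G [F1 [A [B [a [b [EA EB E]]]]]] [G1 [A' [B' [a' [b' [EA' EB' E']]]]]]| | | |].
- exists 0, k%:MP, 0, k%:P%:P, 0; split=> v; rewrite ?eval2E ?mevalC ?meval0 //.
  by move=> _; ring.
- exists (F1 + G1), (A + A'), (B + B'), (a + a'), (b + b').
  by split=> v; rewrite ?eval2E ?mevalD ?EA ?EA' ?EB ?EB' // => Wv;
    rewrite E // E' // EA EA' EB EB'; ring.
(* The first three terms collect the multiples of w in the product of the two decompositions; the
   last one comes from z^2 = -(x^2 + y^2) - w^2. *)
- exists (F1 * G + F * G1 - w * F1 * G1 - w * B * B'),
    (A * A' - (x ^+ 2 + y ^+ 2) * (B * B')), (A * B' + B * A'),
    (a * a' + binary (-1) (-1) * (b * b')), (a * b' + b * a').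
  split=> v; rewrite ?(mevalD, mevalN, mevalM, rmorphXn, eval2E) ?EA ?EA' ?EB ?EB'.
  + by rewrite /binary ?eval2E; ring.
  + by [].
  move=> Wv; have [_ Ev] := (quadricE fW v).1 Wv; rewrite E // E' // EA EA' EB EB' /=.
  apply: subr0_eq; rewrite -(mulr0 (eval2 b x.@[v] y.@[v] * eval2 b' x.@[v] y.@[v])) -Ev.
  ring.
- exists 0, x, 0, 'X, 0; split=> v; rewrite ?eval2E ?meval0 // => _; ring.
- exists 0, y, 0, 'X%:P, 0; split=> v; rewrite ?eval2E ?meval0 // => _; ring.
- exists 0, 0, 1, 0, 1; split=> v; rewrite ?(eval2_nat 1) ?eval2E ?meval0 ?meval1 // => _; ring.
- exists 1, 0, 0, 0, 0; split=> v; rewrite ?eval2E ?meval0 ?meval1 // => _; ring.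
Qed.

(** Stronger than primality: a factor vanishing on the conic is divisible by w on all of [W], which
    is what the maximality of the conic requires. The norm is now that of the quadratic extension by
    z, with z^2 = -(x^2 + y^2). *)
Lemma conic_dichotomy F G : (forall v, conic v -> F.@[v] * G.@[v] = 0) ->
  (exists F1, forall v, W v -> F.@[v] = w.@[v] * F1.@[v]) \/
  (exists G1, forall v, W v -> G.@[v] = w.@[v] * G1.@[v]).
Proof.
move=> FG0.
have [F1 [A [B [a [b [EA EB E]]]]]] := conic_normal_form F.
have [G1 [A' [B' [a' [b' [EA' EB' E']]]]]] := conic_normal_form G.
pose q := binary (-1) (-1) : {poly {poly K}}.
pose N (a b : {poly {poly K}}) := a ^+ 2 - q * b ^+ 2.
have N0 c d : N c d = 0 -> c = 0 /\ d = 0.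
  move=> /eqP; rewrite subr_eq0 => /eqP Ecd.
  have d0 : d = 0.
    by apply: (@binary_nonsquare K (-1) (-1) _ _ d c); rewrite ?oppr_eq0 ?oner_neq0.
  by move: Ecd; rewrite d0 expr0n mulr0 => /eqP; rewrite expf_eq0 => /eqP.
have NN0 : N a b * N a' b' = 0.
  apply: eval2_eq0 => s t t0.
  pose z0 := sqrtC (- (s ^+ 2 + t ^+ 2)).
  have Ez : z0 ^+ 2 = - (s ^+ 2 + t ^+ 2) by exact: sqrtCK.
  have NE c d : eval2 (N c d) s t =
      (eval2 c s t + eval2 d s t * z0) * (eval2 c s t + eval2 d s t * - z0).
    have Ez' : z0 ^+ 2 + s ^+ 2 + t ^+ 2 = 0 by rewrite Ez; ring.
    apply: subr0_eq; rewrite -(mulr0 (eval2 d s t ^+ 2)) -Ez' !eval2E; ring.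
  have val0 z1 : z1 ^+ 2 = z0 ^+ 2 ->
      (eval2 a s t + eval2 b s t * z1) * (eval2 a' s t + eval2 b' s t * z1) = 0.
    move=> Ez1; have [v [vx vy vz vw]] := frame_surj fW s t z1 0.
    have Wv : W v.
      apply/(quadricE fW); split; last by rewrite vx vy vz vw Ez1 Ez; ring.
      by apply/(frame_neq0 fW); rewrite vy t0 orbT.
    have := FG0 v (conj Wv vw).
    by rewrite E // E' // EA EB EA' EB' vx vy vz vw !mul0r !add0r.
  rewrite eval2M !NE.
  transitivity (((eval2 a s t + eval2 b s t * z0) * (eval2 a' s t + eval2 b' s t * z0)) *
    ((eval2 a s t + eval2 b s t * - z0) * (eval2 a' s t + eval2 b' s t * - z0))); first by ring.
  by rewrite val0 // mul0r.
move/eqP: NN0; rewrite mulf_eq0 => /orP[]/eqP/N0[Ea Eb]; [left; exists F1|right; exists G1].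
  by move=> v Wv; rewrite E // EA EB Ea Eb !eval2E; ring.
by move=> v Wv; rewrite E' // EA' EB' Ea Eb !eval2E; ring.
Qed.

Lemma conic_prime : prime_on conic.
Proof.
move=> F G /conic_dichotomy[] [H EH]; [left|right] => v [Wv w0];
  by rewrite EH // w0 mul0r.
Qed.

Lemma frame_closed : zariski_closed W.
Proof.
rewrite (frame_quadric fW); eexists; split; last reflexivity.
move=> _ ->; exists 2%N; have [hx hy hz hw] := frame_homog fW.
by rewrite !rpredD // (dhomogM (d := 1) (e := 1)).
Qed.

Lemma conic_divides d F : F \is d.+1.-homog -> vanishing_ideal conic F ->
  exists2 F1, F1 \is d.-homog & forall v, W v -> F.@[v] = w.@[v] * F1.@[v].
Proof.
move=> hF CF; have [F1 EF] : exists F1, forall v, W v -> F.@[v] = w.@[v] * F1.@[v].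
  by have [|//|//] := @conic_dichotomy F F; move=> v /CF ->; rewrite mul0r.
(* The quotient need not be homogeneous; its component of degree [d] suffices, by comparing the
   coefficients of degree d + 1 on the line through each point. *)
exists (pihomog mdeg d F1); first exact: pihomogP.
move=> v Wv; have [_ _ _ hw] := frame_homog fW.
have P0 : F.@[v] *: 'X^(d.+1) - (w.@[v] *: homog_poly F1 v) * 'X = 0.
  apply: (@poly_eq0_off _ _ 'X); first by rewrite polyX_eq0.
  move=> c; rewrite hornerX => c0.
  have := EF _ (closed_scale frame_closed Wv c0).
  rewrite (meval_homogZ _ _ hF) (meval_homogZ _ _ hw) -horner_homog_poly.
  rewrite !(hornerD, hornerN, hornerM, hornerZ, hornerXn, hornerX) mulrC => ->.
  ring.
have := congr1 (fun p : {poly K} => p`_d.+1) P0.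
rewrite coefB coefZ coefXn eqxx mulr1 coefMX coefZ coef_homog_poly coef0 /=.
by move/eqP; rewrite subr_eq0 => /eqP.
Qed.

Lemma frame_neq0W v : W v -> exists i, v i != 0.
Proof. by move/(quadricE fW) => []. Qed.

Lemma conic_closed : zariski_closed conic.
Proof.
have [A [homA WE]] := frame_closed; exists (A `|` [set w]); split.
  by move=> F [/homA//|->]; exists 1%N; have [] := frame_homog fW.
apply/seteqP; split=> v; rewrite /conic /= WE.
  by move=> [[v0 Av] wv]; split=> // F [/Av|->].
move=> [v0 Hv]; split; last by apply: Hv; right.
by split=> // F AF; apply: Hv; left.
Qed.

Lemma conic_point a b c : a ^+ 2 + b ^+ 2 + c ^+ 2 = 0 -> c != 0 ->
  exists v, [/\ conic v, x.@[v] = a, y.@[v] = b, z.@[v] = c & w.@[v] = 0].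
Proof.
move=> abc c0; have [v [vx vy vz vw]] := frame_surj fW a b c 0; exists v.
split=> //; split=> //; apply/(quadricE fW); rewrite vx vy vz vw abc; split; last by ring.
by apply/(frame_neq0 fW); rewrite vz c0 !orbT.
Qed.

Lemma conic_neq0 : conic !=set0.
Proof.
have [|v [Cv _ _ _ _]] := @conic_point 'i 0 1 _ (oner_neq0 _); last by exists v.
by rewrite sqrCi; ring.
Qed.

Lemma conic_irreducible : zariski_irreducible conic.
Proof.
apply: prime_on_irreducible; [exact: conic_neq0| |exact: conic_prime].
by move=> v [/frame_neq0W].
Qed.

Lemma conic_proper : conic <> W.
Proof.
move=> CW; have [v [vx vy vz vw]] := frame_surj fW 0 0 'i 1.
have : W v.
  apply/(quadricE fW); rewrite vx vy vz vw sqrCi; split; last by ring.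
  by apply/(frame_neq0 fW); rewrite vw oner_neq0 !orbT.
by rewrite -CW => -[_ /eqP]; rewrite vw oner_eq0.
Qed.

(* A form vanishing on Y but not on W is divisible by w only finitely often;
   the last quotient does not vanish on the conic. *)
Lemma conic_maximal Y : zariski_closed Y -> zariski_irreducible Y ->
  conic `<=` Y -> Y `<=` W -> Y <> W -> Y = conic.
Proof.
move=> cY iY CY YW nYW.
have [||d [F [hF YF nF]]] := @closed_proper_form W Y cY; last first.
- suff sub : Y `<=` conic by apply/seteqP.
  elim: d F hF YF nF => [|d IHd] F hF YF nF.
    have [u Cu] := conic_neq0; case: nF => v _.
    (* In degree 0 the scaling rule with factor 0 reads 0^0 = 1, so the value at any vector is the
       value at the origin: the form is constant. *)
    have E v' : F.@[v'] = F.@[fun i => 0 * v' i] by rewrite (meval_homogZ _ _ hF) mul1r.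
    transitivity F.@[u]; last exact/YF/CY.
    rewrite E [RHS]E; congr (meval _ _).
    by apply/funext => i; rewrite !mul0r.
  have [F1 hF1 EF] := conic_divides hF (fun v Cv => YF v (CY _ Cv)).
  have nF1 : ~ vanishing_ideal W F1.
    by apply: contra_not nF => F10 v Wv; rewrite EF // F10 // mulr0.
  have [_ iY'] := iY; have [_ _ _ hw] := frame_homog fW.
  have [| | |sub|sub] := iY' (zero_locus [set w]) (zero_locus [set F1]).
  + by exists [set w]; split=> // _ ->; exists 1%N.
  + by exists [set F1]; split=> // _ ->; exists d.
  + move=> v Yv; have v0 := frame_neq0W (YW _ Yv).
    move/eqP: (YF _ Yv); rewrite EF; last exact: YW.
    by rewrite mulf_eq0 => /orP[]/eqP E; [left|right]; split=> // _ ->.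
  + by move=> v Yv; split; [exact: YW | have [_] := sub v Yv; apply].
  + by apply: (IHd F1) => // v /sub[_]; apply.
- exact: frame_neq0W.
- by move=> WY; apply: nYW; apply/seteqP.
Qed.

Lemma conic_is_prime : is_prime_divisor W conic.
Proof.
split; [exact: conic_closed|exact: conic_irreducible|by move=> v []|exact: conic_proper|].
exact: conic_maximal.
Qed.

Definition conic_divisor : prime_divisor W := exist _ conic conic_is_prime.

(** The maximality of [C] is applied to the closed irreducible proper subset [D]. *)
Lemma prime_divisor_eq (C D : prime_divisor W) : sval C `<=` sval D -> C = D.
Proof.
case: C D => [C pC] [D pD] /= CD.
have E : C = D.
  by case: pC pD => [_ _ _ _ maxC] [cD iD DW nDW _]; rewrite (maxC D).
by subst D; congr exist; apply: Prop_irrelevance.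
Qed.

(** The direction (0, 0, 0, 1) is tangent to [W] all along the plane section, and w has derivative 1
    in it: the plane is nowhere tangent. *)
Lemma transverse_plane : transverse W x y z w w.
Proof.
move=> v Wv wv; have [_ _ _ hw] := frame_homog fW.
have [t [tx ty tz tw]] := frame_surj fW 0 0 0 1; exists t; split.
  by rewrite /dot tx ty tz tw wv; ring.
move=> g k u; exists (1 + (g - k * w.@[u]) *: 'X) => [|e].
  by rewrite !hornerE ?mulr0 ?addr0 oner_neq0.
have -> : (fun i => (1 + g * e) * (v i + e * t i) - e ^+ 2 * k * u i) =
  (fun i => 1 * ((1 + g * e) * v i + ((1 + g * e) * e) * t i) + (- e ^+ 2 * k) * u i).
  by apply/funext => i; ring.
by rewrite !meval_linear // wv tw !hornerE; ring.
Qed.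

Lemma conic_order1 : ~ vanishes_to_order W conic 2 (of_form w).
Proof. by apply: (transverse_order fW transverse_plane) => v []. Qed.

Lemma div_plane : Defs.div (of_form w) = of_prime conic_divisor.
Proof.
apply/funext => C; rewrite /Defs.div /of_prime; case: asboolP => [->|nC] /=.
  rewrite ord_eq1 //; last exact: conic_order1.
  by apply: vanishes_to_order1_form; [exact: conic_neq0 | move=> v []].
have [CC iC CW _ _] := svalP C; have [_ _ _ hw] := frame_homog fW.
have [->//|] := posnP (ord W (sval C) (of_form w)).
move=> /(ord_gt0_vanishing CW CC iC hw) wC; case: nC.
by apply: prime_divisor_eq => v Cv; split; [exact: CW | exact: wC].
Qed.

Lemma conic_class : hyperplane_class W (div_class (of_prime conic_divisor)).
Proof.
exists w; split; [by have [] := frame_homog fW| |by rewrite div_plane].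
apply/eqP => w0; have [v [_ _ _ /eqP]] := frame_surj fW 0 0 0 1.
by rewrite w0 meval0 eq_sym oner_eq0.
Qed.

End OneConic.
End Conics.

(** * Reducible members *)

Section Members.
Variable K : numClosedFieldType.
Notation form := {mpoly K[4]}.
Notation vec := (vec K).
Implicit Types (F G : form) (u v : vec).

Lemma of_prime_effective (W : set vec) (C : prime_divisor W) : effective (of_prime C).
Proof.
split; last by move=> D; rewrite /of_prime; case: asboolP.
apply: (@sub_finite_set _ _ [set C]); last exact: finite_set1.
by move=> D; rewrite /of_prime /=; case: asboolP => [->//|_]; rewrite eqxx.
Qed.

Lemma of_prime_neq0 (W : set vec) (C : prime_divisor W) : of_prime C <> zero_divisor (W:=W).
Proof.
by move/(congr1 (fun D : divisor W => D C)); rewrite /of_prime /zero_divisor; case: asboolP.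
Qed.

(** A rotation in the last two coordinates preserves z^2 + w^2. It turns any plane a z + b w = 0
    with a^2 + b^2 = 1 into the last coordinate plane, so that the results on [conic] apply. *)
Lemma rotate_frame (W : set vec) (x y z w : form) (a b : K) : frame W x y z w ->
  a ^+ 2 + b ^+ 2 = 1 -> frame W x y (b *: z - a *: w) (a *: z + b *: w).
Proof.
move=> [[hx hy hz hw] gen surj qW] ab; split.
- by split; rewrite ?(rpredD, rpredN, rpredZ).
- move=> i; have [p [q [r [s ->]]]] := gen i.
  exists p, q, (b * r - a * s), (a * r + b * s).
  rewrite -!mul_mpolyC !(mpolyCD, mpolyCN, mpolyCB, mpolyCM).
  have {}ab : a%:MP ^+ 2 + b%:MP ^+ 2 = 1 :> form.
    by rewrite -mpolyC1 -ab mpolyCD !expr2 !mpolyCM.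
  apply: subr0_eq.
  transitivity ((1 - (a%:MP ^+ 2 + b%:MP ^+ 2)) * (r%:MP * z + s%:MP * w)); first by ring.
  by rewrite ab subrr mul0r.
- move=> p q r s; have [v [vx vy vz vw]] := surj p q (b * r + a * s) (- a * r + b * s).
  exists v; split=> //; rewrite mevalD ?mevalN !mevalZ vz vw.
    transitivity ((a ^+ 2 + b ^+ 2) * r); first by ring.
    by rewrite ab mul1r.
  transitivity ((a ^+ 2 + b ^+ 2) * s); first by ring.
  by rewrite ab mul1r.
rewrite qW; congr (zero_locus [set _]).
rewrite -!mul_mpolyC.
have {}ab : a%:MP ^+ 2 + b%:MP ^+ 2 = 1 :> form.
  by rewrite -mpolyC1 -ab mpolyCD !expr2 !mpolyCM.
rewrite -[LHS]addrA -[RHS]addrA; congr (_ + _).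
transitivity ((a%:MP ^+ 2 + b%:MP ^+ 2) * (z ^+ 2 + w ^+ 2)); last by ring.
by rewrite ab mul1r.
Qed.

Section SplitMember.
Variables (W : set vec) (x1 y1 z1 w1 x2 y2 z2 w2 : form) (F : form) (e : K).
Hypotheses (fW1 : frame W x1 y1 z1 w1) (fW2 : frame W x2 y2 z2 w2).
Hypothesis e0 : e != 0.
Hypothesis w1_conic2 : ~ vanishing_ideal (conic W w2) w1.
Hypothesis w2_conic1 : ~ vanishing_ideal (conic W w1) w2.
Hypothesis hF : F \is 2.-homog.
Hypothesis EF : forall v, W v -> F.@[v] = e * w1.@[v] * w2.@[v].

(** A multiplier [h] showing order 2 for [F] would give the multiplier [h * g] showing order 2 for
    w; by primality [h * g] still does not vanish on the conic. *)
Lemma ord_conic_product (x y z w g : form) : frame W x y z w ->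
  ~ vanishing_ideal (conic W w) g -> (forall v, W v -> F.@[v] = g.@[v] * w.@[v]) ->
  ord W (conic W w) (of_form F) = 1%N.
Proof.
move=> fW ng E; apply: ord_eq1.
  apply: vanishes_to_order1_form; first exact: conic_neq0 fW.
  by move=> v [Wv wv]; rewrite E // wv mulr0.
move=> [h [G [nh GI hG]]]; apply: (conic_order1 fW); exists (h * g), G; split=> //.
  move=> hg0; have [] := @conic_prime _ _ _ _ _ _ fW h g => //.
  by move=> v /hg0; rewrite mevalM.
by move=> v Wv; rewrite -hG // /of_form E // mevalM mulrA.
Qed.

Lemma split_component (C : prime_divisor W) : 0 < Defs.div (of_form F) C ->
  C = conic_divisor fW1 \/ C = conic_divisor fW2.
Proof.
have [CC iC CW _ _] := svalP C; have [_ _ _ hw1] := frame_homog fW1.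
have [_ _ _ hw2] := frame_homog fW2.
move=> /(ord_gt0_vanishing CW CC iC hF) FC.
have [w1C|nw1] := pselect (vanishing_ideal (sval C) w1).
  by left; apply: prime_divisor_eq => v Cv; split; [exact: CW|exact: w1C].
right; apply: prime_divisor_eq => v Cv; split; first exact: CW.
apply: (irreducible_mul_form CC iC hw2 nw1) Cv => u Cu.
by apply: (mulfI e0); rewrite mulr0 mulrA -EF ?FC //; exact: CW.
Qed.

Lemma split_div : Defs.div (of_form F) =
  add_divisor (of_prime (conic_divisor fW1)) (of_prime (conic_divisor fW2)).
Proof.
have E1 : Defs.div (of_form F) (conic_divisor fW1) = 1.
  rewrite /Defs.div (@ord_conic_product _ _ _ _ (e *: w2) fW1) //.
    apply: contra_not w2_conic1 => H v /H/eqP.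
    by rewrite mevalZ mulf_eq0 (negPf e0) => /eqP.
  by move=> v Wv; rewrite EF // mevalZ; ring.
have E2 : Defs.div (of_form F) (conic_divisor fW2) = 1.
  rewrite /Defs.div (@ord_conic_product _ _ _ _ (e *: w1) fW2) //.
    apply: contra_not w1_conic2 => H v /H/eqP.
    by rewrite mevalZ mulf_eq0 (negPf e0) => /eqP.
  by move=> v Wv; rewrite EF // mevalZ; ring.
have ne : conic_divisor fW1 <> conic_divisor fW2.
  by move/(congr1 sval) => /= E; apply: w2_conic1; rewrite E => v [].
apply/funext => C; rewrite /add_divisor /of_prime.
case: asboolP => [->|n1]; first by rewrite E1; case: asboolP => // /ne.
case: asboolP => [->|n2]; first by rewrite E2.
have [|] := posnP (ord W (sval C) (of_form F)).
  by rewrite /Defs.div => ->.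
by move=> /(@split_component C)[].
Qed.

Lemma split_reducible : reducible_divisor (Defs.div (of_form F) : divisor W).
Proof.
exists (of_prime (conic_divisor fW1)), (of_prime (conic_divisor fW2)).
by split; [exact: of_prime_effective|exact: of_prime_effective
  |exact: of_prime_neq0|exact: of_prime_neq0|exact: split_div].
Qed.

Lemma split_class (C : prime_divisor W) : 0 < Defs.div (of_form F) C ->
  hyperplane_class W (div_class (of_prime C)).
Proof. by move=> /split_component[]->; exact: conic_class. Qed.

End SplitMember.

(** With k^2 = -d/c the form factors as c (z - k w)(z + k w). Dividing each factor by n, where n^2 =
    1 + k^2, makes it the last coordinate of a rotated frame; c ≠ d is what makes n nonzero. *)
Lemma rank2_member (W : set vec) (x y z w : form) (F : form) (c d : K) :
  frame W x y z w -> c != 0 -> d != 0 -> c != d -> F \is 2.-homog ->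
  (forall v, W v -> F.@[v] = c * z.@[v] ^+ 2 + d * w.@[v] ^+ 2) ->
  reducible_divisor (Defs.div (of_form F) : divisor W) /\
  forall C : prime_divisor W, 0 < Defs.div (of_form F) C ->
    hyperplane_class W (div_class (of_prime C)).
Proof.
move=> fW c0 d0 cd hF EF.
pose k := sqrtC (- d / c); have Ek : k ^+ 2 = - d / c by exact: sqrtCK.
have Ed : d = - c * k ^+ 2 by rewrite Ek; field.
pose n := sqrtC (1 + k ^+ 2); have En : n ^+ 2 = 1 + k ^+ 2 by exact: sqrtCK.
have k0 : k != 0 by apply: contra_neq d0 => k0; rewrite Ed k0 expr0n mulr0.
have n0 : n != 0.
  apply: contra_neq cd => n0; apply: subr0_eq; rewrite Ed.
  by transitivity (c * (1 + k ^+ 2)); [ring | rewrite -En n0 expr0n mulr0].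
have rot l : l ^+ 2 = k ^+ 2 -> n^-1 ^+ 2 + (- l / n) ^+ 2 = 1.
  by move=> El; rewrite exprMn sqrrN El exprVn En; field; rewrite -En expf_neq0.
have f1 := rotate_frame fW (rot k erefl).
have f2 := rotate_frame fW (rot (- k) (sqrrN k)).
have nv l : l != 0 -> l ^+ 2 = k ^+ 2 -> ~ vanishing_ideal
    (conic W (n^-1 *: z + (- l / n) *: w)) (n^-1 *: z + (l / n) *: w).
  move=> l0 El; have f := rotate_frame fW (rot l El).
  (* The point (i, 0, 1, 0) of the rotated frame lies on one conic, and the other linear factor
     takes the nonzero value -2 l / n^2 there. *)
  have [|v [Cv vx vy vz vw]] := conic_point f (a := 'i) (b := 0) (c := 1) _ (oner_neq0 _).
    by rewrite sqrCi; ring.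
  move=> /(_ _ Cv)/eqP; apply/negP; move: vz vw.
  rewrite !(mevalD, mevalN, mevalZ) => Hz Hw.
  have -> : n^-1 * z.@[v] + l / n * w.@[v] = - (2%:R * l) / n ^+ 2.
    have Elw : z.@[v] = l * w.@[v].
      by apply: subr0_eq; rewrite -(mulr0 n) -Hw; field; exact: n0.
    have Ew : w.@[v] = - n^-1.
      have Enw : n ^+ 2 * w.@[v] = - n.
        rewrite En -El; transitivity (- n * (- l / n * z.@[v] - n^-1 * w.@[v])).
          by rewrite Elw; field; exact: n0.
        by rewrite Hz mulr1.
      by apply: (mulfI (expf_neq0 2 n0)); rewrite Enw; field; exact: n0.
    have Ez : z.@[v] = - l / n by rewrite Elw Ew; ring.
    rewrite Ew Ez; field.
    exact: n0.
  by rewrite !mulf_neq0 ?oppr_eq0 ?invr_eq0 ?expf_neq0 ?mulf_neq0 ?pnatr_eq0.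
have E v : W v -> F.@[v] = (c * n ^+ 2) * (n^-1 *: z + (- k / n) *: w).@[v] *
                     (n^-1 *: z + (- - k / n) *: w).@[v].
  move=> Wv; rewrite EF // Ed !(mevalD, mevalZ); field; exact: n0.
split.
  apply: (split_reducible f1 f2 _ _ _ hF E).
  - by rewrite mulf_neq0 ?expf_neq0.
  - by have := nv (- k); rewrite opprK oppr_eq0 sqrrN; apply.
  - by rewrite opprK; apply: nv.
move=> C; apply: (split_class f1 f2 _ hF E).
by rewrite mulf_neq0 ?expf_neq0.
Qed.

End Members.

(** * Irreducible members *)

Section Elliptic.
Variable K : numClosedFieldType.
Notation form := {mpoly K[4]}.
Notation vec := (vec K).
Implicit Types (F G : form) (u v : vec).

Definition diagonal_form (x y z w : form) (a b c d : K) : form :=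
  a *: x ^+ 2 + b *: y ^+ 2 + c *: z ^+ 2 + d *: w ^+ 2.

Lemma meval_diagonal_form x y z w a b c d v : (diagonal_form x y z w a b c d).@[v] =
  a * x.@[v] ^+ 2 + b * y.@[v] ^+ 2 + c * z.@[v] ^+ 2 + d * w.@[v] ^+ 2.
Proof. by rewrite !(mevalD, mevalZ, rmorphXn). Qed.

(** A nonzero isotropic vector has two nonzero coordinates p, q. The direction (q, -p) in their
    plane is orthogonal to it and gives the difference of the two coefficients times p q. *)
Lemma orthogonal_direction (a b c d x y z w : K) :
  [&& a != b, a != c, a != d, b != c, b != d & c != d] ->
  [|| x != 0, y != 0, z != 0 | w != 0] -> x ^+ 2 + y ^+ 2 + z ^+ 2 + w ^+ 2 = 0 ->
  exists x' y' z' w', x * x' + y * y' + z * z' + w * w' = 0 /\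
    a * x * x' + b * y * y' + c * z * z' + d * w * w' != 0.
Proof.
move=> /and5P[ab ac ad bc /andP[bd cd]] nz E.
have [y0|y0] := eqVneq y 0; last first.
  have [x0|x0] := eqVneq x 0; last first.
    exists y, (- x), 0, 0; split; first by ring.
    have -> : a * x * y + b * y * - x + c * z * 0 + d * w * 0 = (a - b) * (x * y) by ring.
    by rewrite !mulf_neq0 ?subr_eq0.
  have [z0|z0] := eqVneq z 0; last first.
    exists 0, z, (- y), 0; split; first by ring.
    have -> : a * x * 0 + b * y * z + c * z * - y + d * w * 0 = (b - c) * (y * z) by ring.
    by rewrite !mulf_neq0 ?subr_eq0.
  have [w0|w0] := eqVneq w 0; last first.
    exists 0, w, 0, (- y); split; first by ring.
    have -> : a * x * 0 + b * y * w + c * z * 0 + d * w * - y = (b - d) * (y * w) by ring.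
    by rewrite !mulf_neq0 ?subr_eq0.
  by move/eqP: E; rewrite x0 z0 w0 expr0n !addr0 add0r expf_eq0 (negPf y0).
have [z0|z0] := eqVneq z 0; last first.
  have [x0|x0] := eqVneq x 0; last first.
    exists z, 0, (- x), 0; split; first by ring.
    have -> : a * x * z + b * y * 0 + c * z * - x + d * w * 0 = (a - c) * (x * z) by ring.
    by rewrite !mulf_neq0 ?subr_eq0.
  have [w0|w0] := eqVneq w 0; last first.
    exists 0, 0, w, (- z); split; first by ring.
    have -> : a * x * 0 + b * y * 0 + c * z * w + d * w * - z = (c - d) * (z * w) by ring.
    by rewrite !mulf_neq0 ?subr_eq0.
  by move/eqP: E; rewrite x0 y0 w0 expr0n !addr0 !add0r expf_eq0 (negPf z0).
have [x0|x0] := eqVneq x 0.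
  move: nz; rewrite x0 y0 z0 eqxx /= => w0.
  by move/eqP: E; rewrite x0 y0 z0 expr0n !add0r expf_eq0 (negPf w0).
have [w0|w0] := eqVneq w 0.
  by move/eqP: E; rewrite y0 z0 w0 expr0n !addr0 expf_eq0 (negPf x0).
exists w, 0, 0, (- x); split; first by ring.
have -> : a * x * w + b * y * 0 + c * z * 0 + d * w * - x = (a - d) * (x * w) by ring.
by rewrite !mulf_neq0 ?subr_eq0.
Qed.

Section OneElliptic.
Variables (W : set vec) (x y z w : form) (a b c d : K).
Hypothesis fW : frame W x y z w.
Hypothesis abcd : [&& a != b, a != c, a != d, b != c, b != d & c != d].
Let F := diagonal_form x y z w a b c d.

Lemma diagonal_form_homog : F \is 2.-homog.
Proof.
have [hx hy hz hw] := frame_homog fW.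
by rewrite !rpredD ?rpredZ // (dhomogM (d := 1) (e := 1)).
Qed.

Lemma transverse_diagonal_form : transverse W x y z w F.
Proof.
move=> v Wv Fv; have [hx hy hz hw] := frame_homog fW.
have [/(frame_neq0 fW) v0 Ev] := (quadricE fW v).1 Wv.
have [x' [y' [z' [w' [E1 E2]]]]] := orthogonal_direction abcd v0 Ev.
have [t [tx ty tz tw]] := frame_surj fW x' y' z' w'; exists t.
split; first by rewrite /dot tx ty tz tw.
move=> g k u.
pose D (p q : vec) := a * x.@[p] * x.@[q] + b * y.@[p] * y.@[q] + c * z.@[p] * z.@[q] +
  d * w.@[p] * w.@[q].
have Dvt : D v t != 0 by rewrite /D tx ty tz tw.
have Dvv : D v v = 0 by rewrite -Fv /F meval_diagonal_form /D; ring.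
(* This is the value of [F] on the curve divided by the parameter, expanded through the bilinear
   form [D] with D v v = 0; its value at 0 is 2 D v t. *)
exists ((1 + g *: 'X) ^+ 2 * ((2%:R * D v t)%:P + D t t *: 'X)
   - (2%:R * k) *: ((1 + g *: 'X) * 'X * ((D v u)%:P + D t u *: 'X))
   + (k ^+ 2 * D u u) *: 'X^3) => [|e].
  have H1 (f : K) : (1 + g *: 'X).[f] = 1 + g * f by rewrite !hornerE.
  rewrite !(hornerD, hornerN, horner_exp, hornerM, hornerZ, hornerC, hornerX, H1).
  have -> : (1 + g * 0) ^+ 2 * (2%:R * D v t + D t t * 0)
      - 2%:R * k * ((1 + g * 0) * 0 * (D v u + D t u * 0))
      + k ^+ 2 * D u u * 0 ^+ 3 = 2%:R * D v t.
    by rewrite expr0n /=; ring.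
  by rewrite mulf_neq0 ?pnatr_eq0.
have -> : (fun i => (1 + g * e) * (v i + e * t i) - e ^+ 2 * k * u i) =
  (fun i => 1 * ((1 + g * e) * v i + ((1 + g * e) * e) * t i) + (- e ^+ 2 * k) * u i).
  by apply/funext => i; ring.
rewrite /F meval_diagonal_form !meval_linear //.
have H1 (f : K) : (1 + g *: 'X).[f] = 1 + g * f by rewrite !hornerE.
rewrite !(hornerD, hornerN, horner_exp, hornerM, hornerZ, hornerC, hornerX, H1).
apply: subr0_eq; rewrite -(mulr0 ((1 + g * e) ^+ 2)) -Dvv /D; ring.
Qed.

Let X : set vec := [set v | W v /\ F.@[v] = 0].

Lemma elliptic_prime : prime_on X.
Proof.
have /and5P[ab ac ad bc /andP[bd cd]] := abcd.
have cd0 : c - d != 0 by rewrite subr_eq0.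
have dc0 : d - c != 0 by rewrite subr_eq0 eq_sym.
have XE v : X v -> x.@[v] ^+ 2 + y.@[v] ^+ 2 + z.@[v] ^+ 2 + w.@[v] ^+ 2 = 0 /\
    a * x.@[v] ^+ 2 + b * y.@[v] ^+ 2 + c * z.@[v] ^+ 2 + d * w.@[v] ^+ 2 = 0.
  by move=> [/(quadricE fW)[_ ->]]; rewrite /F meval_diagonal_form.
(* The two equations are solved for z^2 and w^2 in terms of x^2 and y^2. The determinant of the
   solution is (a - b) / (c - d), so distinct coefficients give all the nonvanishing conditions. *)
apply: (@biquadratic_prime _ _ _ _ _ (frame_gen fW) X
  ((a - d) / (d - c)) ((b - d) / (d - c)) ((a - c) / (c - d)) ((b - c) / (c - d))).
- by rewrite mulf_neq0 ?invr_eq0 // subr_eq0.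
- by rewrite mulf_neq0 ?invr_eq0 // subr_eq0.
- by rewrite mulf_neq0 ?invr_eq0 // subr_eq0.
- by rewrite mulf_neq0 ?invr_eq0 // subr_eq0.
- rewrite -subr_eq0.
  have -> : (a - d) / (d - c) * ((b - c) / (c - d)) - (b - d) / (d - c) * ((a - c) / (c - d))
    = (a - b) / (c - d) by field; rewrite cd0 dc0.
  by rewrite mulf_neq0 ?invr_eq0 // subr_eq0.
- move=> v /XE[E1 E2]; apply: (mulfI dc0); apply: subr0_eq.
  transitivity (d * 0 - 0 : K); last by ring.
  by rewrite -{1}E1 -E2; field.
- move=> v /XE[E1 E2]; apply: (mulfI cd0); apply: subr0_eq.
  transitivity (c * 0 - 0 : K); last by ring.
  by rewrite -{1}E1 -E2; field.
move=> x0 y0 z0 w0 ny0 Ez Ew; have [v [vx vy vz vw]] := frame_surj fW x0 y0 z0 w0.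
exists v; split=> //; split.
  apply/(quadricE fW); split; first by apply/(frame_neq0 fW); rewrite vy ny0 orbT.
  by rewrite vx vy vz vw Ez Ew; field; rewrite cd0 dc0.
by rewrite /F meval_diagonal_form vx vy vz vw Ez Ew; field; rewrite cd0 dc0.
Qed.

Lemma elliptic_closed : zariski_closed X.
Proof.
have [A [homA WE]] := frame_closed fW; exists (A `|` [set F]); split.
  by move=> G [/homA//|->]; exists 2%N; exact: diagonal_form_homog.
apply/seteqP; split=> v; rewrite /X /= WE.
  by move=> [[v0 Av] Fv]; split=> // G [/Av|->].
move=> [v0 Hv]; split; last by apply: Hv; right.
by split=> // G AG; apply: Hv; left.
Qed.

Lemma elliptic_proper : X <> W.
Proof.
move=> XW; have [v [vx vy vz vw]] := frame_surj fW 'i 1 0 0.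
have : W v.
  apply/(quadricE fW); rewrite vx vy vz vw sqrCi; split; last by ring.
  by apply/(frame_neq0 fW); rewrite vy oner_neq0 !orbT.
rewrite -XW => -[_ /eqP]; rewrite /F meval_diagonal_form vx vy vz vw sqrCi.
have -> : a * -1 + b * 1 ^+ 2 + c * 0 ^+ 2 + d * 0 ^+ 2 = b - a.
  by rewrite expr0n /=; ring.
by rewrite subr_eq0 eq_sym; have /and5P[/negPf ->] := abcd.
Qed.

Lemma elliptic_component (C : prime_divisor W) :
  0 < Defs.div (of_form F) C -> sval C = X.
Proof.
have [CC iC CW _ maxC] := svalP C.
move=> /(ord_gt0_vanishing CW CC iC diagonal_form_homog) FC.
have CX : sval C `<=` X by move=> v Cv; split; [exact: CW|exact: FC].
apply/esym/maxC => //; [exact: elliptic_closed| |by move=> v []|exact: elliptic_proper].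
apply: prime_on_irreducible; [|by move=> v [/(frame_neq0W fW)]|exact: elliptic_prime].
by have [[v Cv] _] := iC; exists v; apply: CX.
Qed.

(** Each nonzero effective summand must contain the only possible component, so it would have
    multiplicity at least 2, against transversality. *)
Lemma elliptic_irreducible : ~ reducible_divisor (Defs.div (of_form F) : divisor W).
Proof.
move=> [D1 [D2 [[_ D1ge] [_ D2ge] D1n D2n E]]].
have pos (D : divisor W) : (forall C, 0 <= D C) -> D <> zero_divisor (W:=W) ->
    exists C, 1 <= D C.
  move=> D0 Dn; apply: contrapT => nC; apply: Dn; apply/funext => C.
  apply/eqP; rewrite eq_le D0 andbT leNgt; apply/negP => DC.
  by apply: nC; exists C; rewrite -gtz0_ge1.
have [C1 HC1] := pos _ D1ge D1n; have [C2 HC2] := pos _ D2ge D2n.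
have X1 : sval C1 = X.
  by apply: elliptic_component; rewrite E ltr_wpDr // (lt_le_trans _ HC1).
have X2 : sval C2 = X.
  by apply: elliptic_component; rewrite E ltr_wpDl // (lt_le_trans _ HC2).
have C12 : C1 = C2 by apply: prime_divisor_eq; rewrite X1 X2.
have : 1 + 1 <= Defs.div (of_form F) C1 by rewrite E lerD // C12.
rewrite /Defs.div lez_nat leqNgt ltnS ord_le1 // X1.
by apply: (transverse_order fW transverse_diagonal_form) => v [].
Qed.

End OneElliptic.
End Elliptic.

(** * Diagonalization *)

Section Diagonalization.
Variable K : numClosedFieldType.
Notation form := {mpoly K[4]}.
Notation vec := (vec K).
Implicit Types (F G q : form) (u v : vec).

(** Gram-Schmidt for a nondegenerate symmetric form, one row at a time: a nonisotropic vector
    orthogonal to the previous rows is normalized by a square root. *)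
Lemma orthonormal_rows (n : nat) (M : 'M[K]_n) (k : nat) : M^T = M ->
  row_free M -> (k <= n)%N -> exists U : 'M[K]_(k, n), U *m M *m U^T = 1%:M.
Proof.
move=> symM freeM; elim: k => [_|k IHk kn].
  by exists 0; apply/matrixP => -[].
have [U EU] := IHk (ltnW kn).
have [v [vU vv]] : exists v : 'rV_n, v *m (M *m U^T) = 0 /\ (v *m M *m v^T) 0 0 = 1.
  have : kermx (M *m U^T) != 0.
    by rewrite -mxrank_eq0 mxrank_ker -lt0n subn_gt0 (leq_ltn_trans (rank_leq_col _)).
  move=> /rowV0Pn[v0 /sub_kermxP v0U v0n].
  suff [v [vU vv]] : exists v : 'rV_n, v *m (M *m U^T) = 0 /\ (v *m M *m v^T) 0 0 != 0.
    pose s := sqrtC ((v *m M *m v^T) 0 0); exists (s^-1 *: v); split.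
      by rewrite -scalemxAl vU scaler0.
    rewrite linearZ /= -!scalemxAl -scalemxAr scalerA [LHS]mxE.
    have -> : (v *m M *m v^T) 0 0 = s ^+ 2 by rewrite sqrtCK.
    by field; rewrite sqrtC_eq0.
  (* An isotropic orthogonal complement of the rows would meet the kernel of [M]. *)
  apply: contrapT => iso.
  have {}iso (v : 'rV_n) : v *m (M *m U^T) = 0 -> (v *m M *m v^T) 0 0 = 0.
    by move=> vU; apply/eqP/negPn/negP => vv; apply: iso; exists v.
  have mxD (A B : 'M[K]_1) : (A + B) 0 0 = A 0 0 + B 0 0 by rewrite mxE.
  have polar (w : 'rV_n) : w *m (M *m U^T) = 0 -> (v0 *m M *m w^T) 0 0 = 0.
    move=> wU; have := iso (v0 + w); rewrite mulmxDl v0U wU addr0 => /(_ erefl).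
    rewrite linearD /= !mulmxDl !mulmxDr !mxD !iso // add0r addr0.
    have -> : (w *m M *m v0^T) 0 0 = (v0 *m M *m w^T) 0 0.
      transitivity ((v0 *m M *m w^T)^T 0 0); last by rewrite mxE.
      by rewrite !trmx_mul trmxK symM mulmxA.
    by rewrite -mulr2n => /eqP; rewrite mulrn_eq0 => /eqP.
  have v0M : v0 *m M = 0.
    suff E (w : 'rV_n) : (v0 *m M *m w^T) 0 0 = 0.
      apply/rowP => j; have := E (delta_mx 0 j).
      by rewrite trmx_delta -colE !mxE.
    (* The orthogonal projection of [w] away from the rows of [U]; [v0] is orthogonal both to it and
       to the rows. *)
    pose w' := w - w *m M *m U^T *m U.
    have -> : w = w' + w *m M *m U^T *m U by rewrite subrK.
    rewrite linearD /= mulmxDr mxD polar ?add0r.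
      by rewrite trmx_mul !mulmxA -[v0 *m M *m U^T]mulmxA v0U mul0mx mxE.
    by rewrite /w' mulmxBl -!mulmxA [U *m (M *m _)]mulmxA EU mulmx1 subrr.
  case/eqP: v0n; apply: (row_free_inj freeM); by rewrite v0M mul0mx.
rewrite -addn1; exists (col_mx U v).
rewrite tr_col_mx mul_col_mx mul_col_row scalar_mx_block EU.
have -> : v *m M *m U^T = 0 by rewrite -mulmxA.
have -> : U *m M *m v^T = 0.
  by apply: trmx_inj; rewrite !trmx_mul trmxK symM vU trmx0.
by congr block_mx; apply/matrixP => i j; rewrite !ord1 vv mxE eqxx.
Qed.

Definition quadratic (M : 'M[K]_4) : form := \sum_i \sum_j M i j *: ('X_i * 'X_j).

Lemma quadratic_homog2 q : q \is 2.-homog -> exists M, q = quadratic M.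
Proof.
move=> /dhomogP hq; rewrite [q]mpolyE.
pose P q := exists M, q = quadratic M.
rewrite -/(P _) big_seq; apply: big_ind.
- exists 0; rewrite /quadratic big1 // => i _; rewrite big1 // => j _.
  by rewrite mxE scale0r.
- move=> _ _ [M ->] [N ->]; exists (M + N); rewrite /quadratic -big_split.
  apply: eq_bigr => i _; rewrite -big_split; apply: eq_bigr => j _.
  by rewrite mxE scalerDl.
move=> m mq; have m2 : mdeg m = 2%N := hq m mq.
have [i mi] : exists i, m i != 0%N.
  apply: contrapT => m0; move: m2; rewrite mdegE big1 // => i _.
  by apply/eqP/negPn/negP => mi; apply: m0; exists i.
have Um : (U_(i) <= m)%MM by rewrite lep1mP.
have /mdeg1P[j /eqP mj] : mdeg (m - U_(i))%MM == 1%N.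
  by rewrite -(eqn_add2r (mdeg U_(i))) -mdegD submK // m2 mdeg1.
exists (q@_m *: delta_mx i j).
rewrite /quadratic (bigD1 i) //= [X in _ + X]big1 ?addr0; last first.
  by move=> k ki; rewrite big1 // => l _; rewrite !mxE (negPf ki) mulr0 scale0r.
rewrite (bigD1 j) //= big1 ?addr0; last first.
  by move=> l lj; rewrite !mxE (negPf lj) andbF mulr0 scale0r.
by rewrite !mxE !eqxx mulr1 -mpolyXD -mj addmC submK.
Qed.

Definition rv v : 'rV[K]_4 := \row_i v i.

Lemma meval_quadratic M v : (quadratic M).@[v] = (rv v *m M *m (rv v)^T) 0 0.
Proof.
transitivity (\sum_i \sum_j v i * M i j * v j).
  rewrite /quadratic (raddf_sum (meval v)); apply: eq_bigr => i _ /=.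
  rewrite (raddf_sum (meval v)); apply: eq_bigr => j _ /=.
  by rewrite mevalZ mevalM !mevalXU; ring.
rewrite exchange_big mxE; apply: eq_bigr => j _.
by rewrite !mxE mulr_suml; apply: eq_bigr => i _; rewrite !mxE.
Qed.

Lemma meval_mderivXU i k v : (mderiv k 'X_i).@[v] = (i == k)%:R.
Proof.
rewrite mderivX mevalZ mnm1E; case: eqVneq => [->|_]; last by rewrite mul0r.
have -> : (U_(k) - U_(k))%MM = 0%MM by apply/mnmP => j; rewrite mnmBE subnn mnm0E.
by rewrite mpolyX0 meval1 mulr1.
Qed.

Lemma meval_mderiv_quadratic M k v :
  (mderiv k (quadratic M)).@[v] = (rv v *m (M + M^T)) 0 k.
Proof.
transitivity (\sum_i \sum_j (M i j * (i == k)%:R * v j + M i j * v i * (j == k)%:R)).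
  rewrite /quadratic (raddf_sum (mderiv k)) (raddf_sum (meval v)); apply: eq_bigr => i _ /=.
  rewrite (raddf_sum (mderiv k)) (raddf_sum (meval v)); apply: eq_bigr => j _ /=.
  by rewrite mderivZ mderivM mevalZ mevalD !mevalM !mevalXU !meval_mderivXU; ring.
have E (f : 'I_4 -> K) : \sum_i f i * (i == k)%:R = f k.
  rewrite (bigD1 k) //= eqxx mulr1 big1 ?addr0 // => i /negPf ->.
  by rewrite mulr0.
under eq_bigr do rewrite big_split /= E.
rewrite big_split /= exchange_big /=.
under eq_bigr do rewrite -mulr_suml E.
rewrite mxE -big_split; apply: eq_bigr => i _ /=.
by rewrite !mxE; ring.
Qed.

(** A vector in the kernel of the symmetric matrix [M] would be a singular point of [W], so [M] is
    invertible and has an orthonormal basis [U]. The dual coordinates are the columns of [P], the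
    inverse of [U], and M = P P^T writes q as a sum of four squares. *)
Lemma smooth_quadric_frame (W : set vec) : smooth_quadric W ->
  exists x y z w, frame W x y z w.
Proof.
move=> [q [hq WE smooth]]; have [N qN] := quadratic_homog2 hq.
pose M := 2%:R^-1 *: (N + N^T).
have symM : M^T = M by rewrite /M linearZ /= linearD /= trmxK addrC.
have qM v : q.@[v] = (rv v *m M *m (rv v)^T) 0 0.
  have E : (rv v *m N^T *m (rv v)^T) 0 0 = (rv v *m N *m (rv v)^T) 0 0.
    transitivity ((rv v *m N *m (rv v)^T)^T 0 0); last by rewrite mxE.
    by rewrite !trmx_mul trmxK mulmxA.
  rewrite qN meval_quadratic /M -scalemxAr -scalemxAl mulmxDr mulmxDl.
  rewrite [RHS]mxE [in RHS]mxE E; by field.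
have freeM : row_free M.
  apply/row_freeP; apply: contrapT => nB.
  have : kermx M != 0.
    by rewrite kermx_eq0; apply/negP => /row_freeP.
  move=> /rowV0Pn[r /sub_kermxP rM r0].
  have [v1 Ev] : exists v1 : vec, v1 = fun i => r 0 i by exists (fun i => r 0 i).
  have rE : rv v1 = r by apply/rowP => i; rewrite mxE Ev.
  have Wv : W v1.
    rewrite WE; split; last by move=> _ ->; rewrite qM rE rM mul0mx mxE.
    apply: contrapT => v0; case/eqP: r0; apply/rowP => i; rewrite mxE.
    by apply/eqP/negPn/negP => ri; apply: v0; exists i; rewrite Ev.
  have [i /eqP[]] := smooth v1 Wv; rewrite qN meval_mderiv_quadratic rE.
  have -> : N + N^T = 2%:R *: M by rewrite scalerA mulfV ?scale1r // pnatr_eq0.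
  by rewrite -scalemxAr rM scaler0 mxE.
have [U EU] := orthonormal_rows symM freeM (leqnn 4).
have [P EP UP] : exists2 P, P = M *m U^T & U *m P = 1%:M.
  by exists (M *m U^T); rewrite // mulmxA.
have PU : P *m U = 1%:M by apply: mulmx1C.
pose L j : form := \sum_i P i j *: 'X_i.
have LE j v : (L j).@[v] = (rv v *m P) 0 j.
  rewrite (raddf_sum (meval v)) mxE; apply: eq_bigr => i _ /=.
  by rewrite mevalZ mevalXU mxE mulrC.
have hL j : L j \is 1.-homog.
  by apply: rpred_sum => i _; apply: rpredZ; rewrite dhomogX; apply/eqP/mdeg1.
pose i0 : 'I_4 := ord0; pose i1 : 'I_4 := inord 1; pose i2 : 'I_4 := inord 2.
pose i3 : 'I_4 := inord 3.
have sum4 (A : zmodType) (f : 'I_4 -> A) : \sum_i f i = f i0 + f i1 + f i2 + f i3.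
  rewrite !big_ord_recl big_ord0 addr0 !addrA.
  by congr (f _ + f _ + f _ + f _); apply/val_inj; rewrite /= ?inordK.
exists (L i0), (L i1), (L i2), (L i3); split.
- by split.
- move=> i; exists (U i0 i), (U i1 i), (U i2 i), (U i3 i).
  rewrite -(sum4 _ (fun j => U j i *: L j)).
  rewrite /L; under eq_bigr do rewrite scaler_sumr.
  rewrite exchange_big /= (bigD1 i) //= [X in _ + X]big1 ?addr0.
    under eq_bigr do rewrite scalerA mulrC.
    rewrite -scaler_suml.
    have := congr1 (fun A : 'M[K]_4 => A i i) PU; rewrite !mxE eqxx => ->.
    by rewrite scale1r.
  move=> k ki; under eq_bigr do rewrite scalerA mulrC.
  rewrite -scaler_suml.
  have := congr1 (fun A : 'M[K]_4 => A k i) PU; rewrite !mxE (negPf ki) => ->.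
  by rewrite scale0r.
- move=> a b c d.
  pose r : 'rV[K]_4 := \row_j (if j == i0 then a else if j == i1 then b
                              else if j == i2 then c else d).
  exists (fun i => (r *m U) 0 i).
  have rE : rv (fun i => (r *m U) 0 i) = r *m U by apply/rowP => i; rewrite mxE.
  have E j : (L j).@[fun i => (r *m U) 0 i] = r 0 j.
    by rewrite LE rE -mulmxA UP mulmx1.
  have ne (m n : nat) : (m < 4)%N -> (n < 4)%N -> (inord m == inord n :> 'I_4) = (m == n).
    by move=> mn nn; rewrite -val_eqE /= !inordK.
  have e0 : i0 = inord 0 by apply/val_inj; rewrite /= inordK.
  by rewrite !E !mxE /i1 /i2 /i3 e0 !ne.
rewrite WE; apply/seteqP.
have E v : q.@[v] = (L i0 ^+ 2 + L i1 ^+ 2 + L i2 ^+ 2 + L i3 ^+ 2).@[v].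
  rewrite !mevalD !rmorphXn /= -(sum4 _ (fun j => (L j).@[v] ^+ 2)) qM.
  have -> : M = P *m P^T by rewrite {2}EP trmx_mul trmxK symM mulmxA PU mul1mx.
  rewrite mulmxA -mulmxA -trmx_mul mxE; apply: eq_bigr => j _.
  by rewrite LE [X in _ * X]mxE.
split=> v [v0 Hv]; split=> // _ ->; first by rewrite -E Hv.
by rewrite E Hv.
Qed.

End Diagonalization.

(** * The pencil *)

Section Pencil.
Variable K : numClosedFieldType.
Notation form := {mpoly K[4]}.
Notation vec := (vec K).
Implicit Types (F G : form) (u v : vec).

Lemma proj_point_div (W : set vec) (s t : vec -> K) : proj_point W s t ->
  Defs.div t = Defs.div s :> divisor W.
Proof. by move=> [c c0 ts]; apply/funext => C; rewrite /Defs.div (ord_scale _ c0 ts). Qed.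

Lemma proj_point_refl (W : set vec) (s : vec -> K) : proj_point W s s.
Proof. by exists 1; rewrite ?oner_neq0 // => v _; rewrite mul1r. Qed.

Lemma reducible_proj_point (W : set vec) (s : vec -> K) :
  reducible_member W (proj_point W s) <-> reducible_divisor (Defs.div s : divisor W).
Proof.
split; first by move=> [t /proj_point_div ->].
by exists s => //; exact: proj_point_refl.
Qed.

Lemma form_section (W : set vec) d F : F \is d.-homog -> is_section W d (of_form F).
Proof.
move=> hF v Wv; exists 0%N, F, 1; split; rewrite ?meval1 ?oner_neq0 ?dhomog1 //.
by move=> u _ _; rewrite meval1 divr1.
Qed.

(** The three adjacent transpositions move any pair of coordinates into the last two places, where
    [rank2_member] expects them. *)
Lemma frame_swap12 (W : set vec) x y z w : frame W x y z w -> frame W y x z w.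
Proof.
move=> [[hx hy hz hw] gen surj ->]; split=> //.
- move=> i; have [a [b [c [d ->]]]] := gen i; exists b, a, c, d.
  by rewrite (addrC (a *: x)).
- by move=> a b c d; have [v [? ? ? ?]] := surj b a c d; exists v.
by rewrite (addrC (x ^+ 2)).
Qed.

Lemma frame_swap23 (W : set vec) x y z w : frame W x y z w -> frame W x z y w.
Proof.
move=> [[hx hy hz hw] gen surj ->]; split=> //.
- move=> i; have [a [b [c [d ->]]]] := gen i; exists a, c, b, d.
  by rewrite (addrAC (a *: x)).
- by move=> a b c d; have [v [? ? ? ?]] := surj a c b d; exists v.
by rewrite (addrAC (x ^+ 2)).
Qed.

Lemma frame_swap34 (W : set vec) x y z w : frame W x y z w -> frame W x y w z.
Proof.
move=> [[hx hy hz hw] gen surj ->]; split=> //.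
- move=> i; have [a [b [c [d ->]]]] := gen i; exists a, b, d, c.
  by rewrite addrAC.
- by move=> a b c d; have [v [? ? ? ?]] := surj a b d c; exists v.
by rewrite addrAC.
Qed.

Section OnePencil.
Variables (W : set vec) (x y z w : form).
Hypothesis fW : frame W x y z w.

(* The member a s + b t of the pencil spanned by the diagonal forms with
   coefficients e and e^2, for e in {0, 1, 2, 4}.  Two coefficients a e + b e^2
   and a e' + b e'^2 agree iff a + b (e + e') = 0, and the six sums e + e' are
   1, ..., 6. *)
Definition member (a b : K) : form := diagonal_form x y z w
  0 (a + b) (2%:R * a + 4%:R * b) (4%:R * a + 16%:R * b).

Lemma member_homog a b : member a b \is 2.-homog.
Proof. exact: diagonal_form_homog fW. Qed.

Lemma memberE a b v : (member a b).@[v] = a * (member 1 0).@[v] + b * (member 0 1).@[v].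
Proof. by rewrite !meval_diagonal_form; ring. Qed.

Lemma member_eq0 a b : (forall v, W v -> (member a b).@[v] = 0) -> a = 0 /\ b = 0.
Proof.
move=> m0.
have [v [vx vy vz vw]] := frame_surj fW 'i 1 0 0.
have E1 : a + b = 0.
  rewrite -(m0 v); first by rewrite meval_diagonal_form vx vy vz vw; ring.
  apply/(quadricE fW); rewrite vx vy vz vw sqrCi; split; last by ring.
  by apply/(frame_neq0 fW); rewrite vy oner_neq0 !orbT.
have [u [ux uy uz uw]] := frame_surj fW 'i 0 1 0.
have E2 : 2%:R * a + 4%:R * b = 0.
  rewrite -(m0 u); first by rewrite meval_diagonal_form ux uy uz uw; ring.
  apply/(quadricE fW); rewrite ux uy uz uw sqrCi; split; last by ring.
  by apply/(frame_neq0 fW); rewrite uz oner_neq0 !orbT.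
have b0 : b = 0.
  have : 2%:R * b = 0.
    by rewrite -[RHS](subr0 0) -{1}E2 -(mulr0 2%:R) -E1; ring.
  by move/eqP; rewrite mulf_eq0 pnatr_eq0 => /eqP.
by split=> //; rewrite -E1 b0 addr0.
Qed.

Lemma member_irreducible a b :
  (forall k : nat, (0 < k <= 6)%N -> a + k%:R * b != 0) ->
  ~ reducible_divisor (Defs.div (of_form (member a b)) : divisor W).
Proof.
move=> ne; apply: (elliptic_irreducible fW).
have ne' (e c d : K) (k : nat) : (0 < k <= 6)%N -> e != 0 -> c - d = e * (a + k%:R * b) ->
    c != d.
  by move=> /ne H e0 E; rewrite -subr_eq0 E mulf_neq0.
have nat0 (n : nat) : n.+1%:R != 0 :> K by rewrite pnatr_eq0.
apply/and5P; split; last (apply/andP; split).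
(* The coefficients at e and e' differ by (e - e')(a + (e + e') b); each line supplies e - e' and
   the sum e + e'. *)
- by apply: (ne' (- 1%:R) _ _ 1%N); rewrite ?oppr_eq0 //; ring.
- by apply: (ne' (- 2%:R) _ _ 2%N); rewrite ?oppr_eq0 //; ring.
- by apply: (ne' (- 4%:R) _ _ 4%N); rewrite ?oppr_eq0 //; ring.
- by apply: (ne' (- 1%:R) _ _ 3%N); rewrite ?oppr_eq0 //; ring.
- by apply: (ne' (- 3%:R) _ _ 5%N); rewrite ?oppr_eq0 //; ring.
- by apply: (ne' (- 2%:R) _ _ 6%N); rewrite ?oppr_eq0 //; ring.
Qed.

Lemma member_reducible b (k : nat) : b != 0 -> (0 < k <= 6)%N ->
  reducible_divisor (Defs.div (of_form (member (- (k%:R * b)) b)) : divisor W) /\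
  forall C : prime_divisor W, 0 < Defs.div (of_form (member (- (k%:R * b)) b)) C ->
    hyperplane_class W (div_class (of_prime C)).
Proof.
move=> b0 k6.
have hF := member_homog (- (k%:R * b)) b.
have rank2 (x' y' z' w' : form) (c d : int) (e : K) : frame W x' y' z' w' ->
  [&& c != 0, d != 0 & c != d] ->
  (forall v, (member (- (k%:R * b)) b).@[v] = e * (x'.@[v] ^+ 2 + y'.@[v] ^+ 2 + z'.@[v] ^+ 2
    + w'.@[v] ^+ 2) + c%:~R * b * z'.@[v] ^+ 2 + d%:~R * b * w'.@[v] ^+ 2) ->
  reducible_divisor (Defs.div (of_form (member (- (k%:R * b)) b)) : divisor W) /\
  forall C : prime_divisor W, 0 < Defs.div (of_form (member (- (k%:R * b)) b)) C ->
    hyperplane_class W (div_class (of_prime C)).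
  move=> f /and3P[c0 d0 cd] E.
  apply: (rank2_member f (c := c%:~R * b) (d := d%:~R * b)) => //.
  - by rewrite mulf_neq0 ?intr_eq0.
  - by rewrite mulf_neq0 ?intr_eq0.
  - by rewrite (inj_eq (mulIf b0)) eqr_int.
  by move=> v Wv; rewrite E; have [_ ->] := (quadricE f v).1 Wv; ring.
case: k k6 hF rank2 => [//|[|[|[|[|[|[|//]]]]]]] _ hF rank2.
(* For the pair e + e' = k, the first two coordinates carry the equal coefficients, whose common
   value -e e' b is the last scalar. The two integers are (t - e)(t - e') at the remaining nodes t;
   they differ because the remaining nodes have sum 7 - k, not k. *)
- apply: (rank2 x y z w 2 12 0) => // v; rewrite meval_diagonal_form; ring.
- apply: (rank2 x z y w (-1) 8 0 (frame_swap23 fW)) => // v.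
  rewrite meval_diagonal_form; ring.
- apply: (rank2 y z x w 2 6 (- 2%:R * b) (frame_swap23 (frame_swap12 fW))) => // v.
  rewrite meval_diagonal_form; ring.
- apply: (rank2 x w y z (-3) (-4) 0 (frame_swap23 (frame_swap34 fW))) => // v.
  rewrite meval_diagonal_form; ring.
- apply: (rank2 y w x z 4 (-2) (- 4%:R * b)
    (frame_swap23 (frame_swap34 (frame_swap12 fW)))) => // v.
  rewrite meval_diagonal_form; ring.
- apply: (rank2 z w x y 8 3 (- 8%:R * b)
    (frame_swap23 (frame_swap34 (frame_swap12 (frame_swap23 fW))))) => // v.
  rewrite meval_diagonal_form; ring.
Qed.

Definition pencil : set (set (vec -> K)) := [set m | exists a b : K,
  (a != 0 \/ b != 0) /\ m = proj_point W (of_form (member a b))].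

Lemma pencil_is_pencil : is_pencil W 2 pencil.
Proof.
have E a b : (fun v => a * of_form (member 1 0) v + b * of_form (member 0 1) v) =
    of_form (member a b) by apply/funext => v; rewrite /of_form -memberE.
exists (of_form (member 1 0)), (of_form (member 0 1)); split.
- exact/form_section/member_homog.
- exact/form_section/member_homog.
- by move=> a b H; apply: member_eq0 => v /H; rewrite memberE.
- apply/seteqP; split=> m [a [b [ab ->]]]; exists a, b; split=> //; by rewrite E.
Qed.

(** The member belonging to the pair of nodes with sum i + 1; the shift makes the indices run from 0
    to 5. *)
Definition special (i : nat) : set (vec -> K) :=
  proj_point W (of_form (member (- i.+1%:R) 1)).

Lemma pencil_reducible m : pencil m -> reducible_member W m ->
  exists2 i, (i < 6)%N & m = special i.
Proof.
move=> [a [b [ab ->]]] /reducible_proj_point red.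
have [k k6 Ek] : exists2 k : nat, (0 < k <= 6)%N & a + k%:R * b = 0.
  apply: contrapT => nk; apply: (member_irreducible _ red) => k k6.
  by apply/eqP => E; apply: nk; exists k.
have Ea : a = - (k%:R * b) by apply: subr0_eq; rewrite opprK.
have b0 : b != 0.
  by case: ab => //; apply: contra_neq => b0; rewrite Ea b0 mulr0 oppr0.
case: k k6 Ek Ea => // i i6 _ Ea; exists i => //.
have E v : (member a b).@[v] = b * (member (- i.+1%:R) 1).@[v].
  by rewrite !meval_diagonal_form Ea; ring.
apply/seteqP; split=> s [c c0 sE].
  exists (c * b); first by rewrite mulf_neq0.
  by move=> v Wv; rewrite sE // /of_form E mulrA.
exists (c / b); first by rewrite mulf_neq0 ?invr_eq0.
by move=> v Wv; rewrite sE // /of_form E; field.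
Qed.

Lemma special_reducible i : (i < 6)%N -> reducible_member W (special i).
Proof.
move=> i6; apply/reducible_proj_point.
by have [] := @member_reducible 1 i.+1 (oner_neq0 _) i6; rewrite mulr1.
Qed.

Lemma special_component i (C : prime_divisor W) : (i < 6)%N -> component (special i) C ->
  hyperplane_class W (div_class (of_prime C)).
Proof.
move=> i6 [s /proj_point_div ->].
by have [_] := @member_reducible 1 i.+1 (oner_neq0 _) i6; rewrite mulr1; apply.
Qed.

(** Two proportional members give a member vanishing on [W]; independence forces the factor to be 1
    and then the indices to agree. *)
Lemma special_inj i j : special i = special j -> i = j.
Proof.
move=> E; have : special j (of_form (member (- i.+1%:R) 1)).
  by rewrite -E; exact: proj_point_refl.
move=> [c c0 H].
have [|E1 E2] := @member_eq0 (- i.+1%:R + c * j.+1%:R) (1 - c).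
  move=> v /H; rewrite /of_form => Hv.
  transitivity ((member (- i.+1%:R) 1).@[v] - c * (member (- j.+1%:R) 1).@[v]).
    by rewrite !meval_diagonal_form; ring.
  by rewrite Hv subrr.
have c1 : c = 1 by apply/esym/subr0_eq.
move/eqP: E1; rewrite c1 mul1r addrC subr_eq0 eqr_nat eqSS.
by move=> /eqP.
Qed.

Lemma card_special : [set m | pencil m /\ reducible_member W m] #= `I_6.
Proof.
have -> : [set m | pencil m /\ reducible_member W m] = special @` `I_6.
  apply/seteqP; split=> m.
    by move=> [pm /(pencil_reducible pm)[i i6 ->]]; exists i.
  move=> [i i6 <-]; split; last exact: special_reducible.
  by exists (- i.+1%:R), 1; split=> //; right; exact: oner_neq0.
by apply: inj_card_eq => i j _ _; exact: special_inj.
Qed.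

End OnePencil.
End Pencil.

Theorem theorem4p1 (R : realType) (W : set (vec R[i])) (hW : smooth_quadric W)
    (nabla : set (set (divisor W)))
    (hnabla : nabla = hyperplane_class W `|` line_classes W)
    (hsat : saturated nabla) :
  exists l : set (set (vec R[i] -> R[i])),
    [/\ is_pencil W 2 l,
        [set m | l m /\ reducible_member W m] #= `I_6
      & forall m, l m -> reducible_member W m ->
          forall C : prime_divisor W, component m C ->
            nabla (div_class (of_prime C))].
Proof.
have [x [y [z [w fW]]]] := smooth_quadric_frame hW.
exists (pencil W x y z w); split.
- exact: pencil_is_pencil fW.
- exact: card_special fW.
move=> m pm /(pencil_reducible fW pm)[i i6 ->] C /(special_component fW i6) hC.
by rewrite hnabla; left.
Qed.
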